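(* Let $d\ge 3$ and $x\in\mathbb{R}^d$ be given. Let $X(t)$, $t\ge0$, be a homogeneous Markov process in $\mathbb{R}^d$ on a probability space $(\Omega,P)$, starting from $x$, whose transition probabilities have a density $p_t(u,y)$ satisfying, for some constants $C_-,c_-,C_+,c_+>0$ and all $t>0$, $u,y\in\mathbb{R}^d$, the two-sided Gaussian bound $$\frac{C_-}{t^{d/2}}\exp\left(-c_-\frac{|u-y|^2}{t}\right)\le p_t(u,y)\le\frac{C_+}{t^{d/2}}\exp\left(-c_+\frac{|u-y|^2}{t}\right).$$ Let $CL(\mathbb{R}^d)=C_b(\mathbb{R}^d)\cap L^1(\mathbb{R}^d)$ with norm $\|f\|_{CL}=\sup|f|+\|f\|_{L^1(\mathbb{R}^d)}$, and put $Y(f)=\int_0^\infty f(X(t))\,\mathrm{d}t$. Then the mapping $$Y: CL(\mathbb{R}^d)\to L^1(\Omega,P)$$ is a continuous linear operator, and it has a unique representation $$Y(f)(\omega)=\int_{\mathbb{R}^d}f(y)\,\mu^x(\mathrm{d}y,\omega)\qquad\text{for all } f\in CL(\mathbb{R}^d)$$ (equality of elements of $L^1(\Omega,P)$), where $\mu^x(\mathrm{d}y,\omega)$ is an $L^1(\Omega,P)$-valued Radon measure on $\mathcal{B}_b(\mathbb{R}^d)$ which is $\sigma$-additive in the strong (norm) topology of $L^1(\Omega,P)$.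
   Context: $C_b(\mathbb{R}^d)$ is the space of bounded continuous real functions on $\mathbb{R}^d$; $\mathcal{B}_b(\mathbb{R}^d)$ is the family of bounded Borel subsets of $\mathbb{R}^d$. The transition density $p_t(u,y)$ satisfies $P_t(u,B)=\int_Bp_t(u,y)\,\mathrm{d}y$, where $P_t(u,B)$ is the probability of transition from $u$ to the Borel set $B$ in time $t>0$. The process is assumed jointly measurable in $(t,\omega)$, so that the integrals $\int_0^Tf(X(t))\,\mathrm{d}t$ make sense. The random variable $Y(f)=\int_0^\infty f(X(t))\,\mathrm{d}t$ is understood as the limit in $L^1(\Omega,P)$, as $T\to\infty$, of $\int_0^T f(X(t))\,\mathrm{d}t$. A vector valued Radon measure means here a set function $\mu:\mathcal{B}_b(\mathbb{R}^d)\to L^1(\Omega,P)$, defined (finite) on every bounded Borel set; $\sigma$-additive in the strong topology means that $\mu(\bigcup_n A_n)=\sum_n\mu(A_n)$ with convergence in $L^1(\Omega,P)$-norm whenever the $A_n\in\mathcal{B}_b(\mathbb{R}^d)$ are pairwise disjoint with $\bigcup_nA_n\in\mathcal{B}_b(\mathbb{R}^d)$. The value $\mu(A)\in L^1(\Omega,P)$ is written $\mu(A,\omega)$. For $f\in CL(\mathbb{R}^d)$, the integral over a ball $B_N(0)=\{|y|\le N\}$ is the usual integral of a bounded Borel function with respect to a vector measure (extension from simple functions by uniform limits), and the integral over $\mathbb{R}^d$ is the $L^1(\Omega,P)$-limit as $N\to\infty$ of the integrals over $B_N(0)$. Uniqueness refers to the measure $\mu^x$. *)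

(* Defs.v *)
From HB Require Import structures.
From mathcomp Require Import all_boot all_order all_algebra generic_quotient ring_quotient.
From mathcomp Require Import all_classical all_reals all_analysis.
From mathcomp Require Import measurable_realfun.
Set Implicit Arguments.
Unset Strict Implicit.
Unset Printing Implicit Defensive.
Import Order.TTheory GRing.Theory Num.Theory.
Import numFieldNormedType.Exports.
Local Open Scope classical_set_scope.
Local Open Scope ring_scope.

Definition rV_display : measure_display.
Proof. exact: default_measure_display. Qed.

Section borel_rV.
Context {R : realType} {n : nat}.

Definition rV_borel : set (set 'rV[R]_n) := <<s @open 'rV[R]_n >>.

Let borel0 : rV_borel set0.
Proof. exact: sigma_algebra0. Qed.

Let borelC A : rV_borel A -> rV_borel (~` A).
Proof. exact: sigma_algebraC. Qed.

Let borel_bigcup (F : (set 'rV[R]_n)^nat) :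
  (forall i, rV_borel (F i)) -> rV_borel (\bigcup_i (F i)).
Proof. exact: sigma_algebra_bigcup. Qed.

HB.instance Definition _ := @isMeasurable.Build rV_display
  'rV[R]_n rV_borel borel0 borelC borel_bigcup.

Lemma open_measurable_rV (U : set 'rV[R]_n) : open U -> measurable U.
Proof. exact: sub_sigma_algebra. Qed.

Lemma continuous_measurable_rV (f : 'rV[R]_n -> R) :
  continuous f -> measurable_fun setT f.
Proof.
move=> cf; apply: (measurability _ (RGenOpens.measurableE R)).
move=> _ [_ [a [b ->] <-]]; rewrite setTI; apply: open_measurable_rV.
by apply: open_comp => [x _|]; [exact: cf|exact: interval_open].
Qed.

Lemma measurable_coord (i : 'I_n) :
  measurable_fun setT (fun v : 'rV[R]_n => v ord0 i).
Proof. by apply: continuous_measurable_rV; exact: coord_continuous. Qed.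

Lemma open_rV_bigcup (U : set 'rV[R]_n) : open U ->
  U = \bigcup_(p in [set p : 'rV[rat]_n * nat |
        ball (map_mx ratr p.1 : 'rV[R]_n) (p.2.+1%:R^-1) `<=` U])
        ball (map_mx ratr p.1 : 'rV[R]_n) (p.2.+1%:R^-1).
Proof.
move=> oU; apply/seteqP; split => [x Ux|x [p]]; last exact.
have /nbhs_ballP[e /= e0 eU] : nbhs x U by exact: open_nbhs_nbhs.
pose k := Num.truncn (2 / e).
have ke : 2 * k.+1%:R^-1 < e.
  by rewrite ltr_pdivrMr// mulrC -ltr_pdivrMr// Num.Theory.truncnS_gt.
have k0 : 0 < k.+1%:R^-1 :> R by rewrite invr_gt0.
have /choice[q qP] : forall i : 'I_n, exists r : rat,
    `|x ord0 i - ratr r| < k.+1%:R^-1 :> R.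
  move=> i; have : x ord0 i - k.+1%:R^-1 < x ord0 i + k.+1%:R^-1.
    by rewrite ltrD2l gtrN.
  move=> /rat_in_itvoo[r]; rewrite in_itv/= => /andP[h1 h2].
  by exists r; rewrite distrC ltr_distl h1 h2.
have bx : ball (map_mx ratr (\row_i q i) : 'rV[R]_n) k.+1%:R^-1 x.
  split => // i j; rewrite !mxE (ord1 i) /ball/=.
  by rewrite distrC; exact: qP.
exists (\row_i q i, k) => //= y yb; apply: eU.
apply: (@le_ball _ _ x (k.+1%:R^-1 + k.+1%:R^-1)).
  by move: ke; rewrite mulr_natl mulr2n; exact: ltW.
exact: ball_triangle (ball_sym bx) yb.
Qed.

End borel_rV.

Lemma measurable_fun_rVP d (T : measurableType d) (R : realType) n
    (f : T -> 'rV[R]_n) :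
  measurable_fun setT f <-> forall i, measurable_fun setT (fun t => f t ord0 i).
Proof.
split=> [mf i|mf].
  exact: (measurableT_comp (measurable_coord i) mf).
apply: (@measurability _ _ _ _ _ _ (@open 'rV[R]_n)) => //.
move=> _ [U oU <-]; rewrite setTI (open_rV_bigcup oU) preimage_bigcup.
rewrite bigcup_mkcond; apply: countable_bigcupT_measurable => [|p].
  exact: countableP.
case: ifPn => // _; set r : R := _^-1.
rewrite (_ : _ @^-1` _ = \bigcap_(i : 'I_n)
    ((fun t => f t ord0 i) @^-1` ball (ratr (p.1 ord0 i) : R) r)).
  apply: fin_bigcap_measurable => // i _; rewrite -[X in measurable X]setTI.
  by apply: mf => //; apply: open_measurable; exact: ball_open.
apply/seteqP; split => t /=.
  by move=> [_ bt] i _; have := bt ord0 i; rewrite !mxE.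
move=> bt; split => [|i j]; first by rewrite invr_gt0.
by rewrite (ord1 i) mxE; exact: bt.
Qed.

Section lebesgue_measure_rV.
Context {R : realType}.

Definition rV_cons n (p : measurableTypeR R * 'rV[R]_n) : 'rV[R]_n.+1 :=
  row_mx (p.1)%:M p.2.

Lemma rV_cons0 n (p : measurableTypeR R * 'rV[R]_n) : rV_cons p ord0 ord0 = p.1.
Proof.
by rewrite mxE; case: splitP => // j /= ; rewrite (ord1 j) mxE eqxx.
Qed.

Lemma rV_consS n (p : measurableTypeR R * 'rV[R]_n) i : rV_cons p ord0 (lift ord0 i) = p.2 ord0 i.
Proof.
rewrite mxE; case: splitP => [j|k] /=; first by rewrite (ord1 j).
by move=> /(@addnI 1)/esym ik; congr (p.2 _ _); exact: val_inj.
Qed.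

Lemma measurable_rV_cons n : measurable_fun setT (@rV_cons n).
Proof.
apply/measurable_fun_rVP => i; have [j ->|->] := unliftP ord0 i.
  under eq_fun do rewrite rV_consS.
  exact: (measurableT_comp (measurable_coord j) measurable_snd).
by under eq_fun do rewrite rV_cons0; exact: measurable_fst.
Qed.

Definition rV_uncons n (v : 'rV[R]_n.+1) : measurableTypeR R * 'rV[R]_n :=
  (v ord0 ord0, \row_i v ord0 (lift ord0 i)).

Lemma rV_consK n : cancel (@rV_cons n) (@rV_uncons n).
Proof.
move=> [t v]; rewrite /rV_uncons rV_cons0; congr pair.
by apply/rowP => i; rewrite mxE rV_consS.
Qed.

Lemma rV_unconsK n : cancel (@rV_uncons n) (@rV_cons n).
Proof.
move=> v; apply/rowP => i; have [j ->|->] := unliftP ord0 i; last by rewrite rV_cons0.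
by rewrite rV_consS mxE.
Qed.

Lemma measurable_rV_uncons n : measurable_fun setT (@rV_uncons n).
Proof.
apply: measurable_fun_pair; first exact: measurable_coord.
apply/measurable_fun_rVP => i; under eq_fun do rewrite mxE.
exact: measurable_coord.
Qed.

HB.instance Definition _ n := isMeasurableFun.Build _ _ _ _ (@rV_cons n)
  (@measurable_rV_cons n).

Section lebesgue_rV_succ.
Variables (n : nat) (m : {sigma_finite_measure set 'rV[R]_n -> \bar R}).

Definition lebesgue_rV_succ : set 'rV[R]_n.+1 -> \bar R :=
  pushforward (@lebesgue_measure R \x m)%E (@rV_cons n).

Let lebesgue_rV_succ0 : lebesgue_rV_succ set0 = 0%E.
Proof. exact: measure0. Qed.

Let lebesgue_rV_succ_ge0 A : (0 <= lebesgue_rV_succ A)%E.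
Proof. exact: measure_ge0. Qed.

Let lebesgue_rV_succ_sigma_additive : semi_sigma_additive lebesgue_rV_succ.
Proof. exact: measure_semi_sigma_additive. Qed.

HB.instance Definition _ := isMeasure.Build _ _ _ lebesgue_rV_succ
  lebesgue_rV_succ0 lebesgue_rV_succ_ge0 lebesgue_rV_succ_sigma_additive.

Let lebesgue_rV_succ_sigma_finite : sigma_finite setT lebesgue_rV_succ.
Proof.
have /sigma_finiteP[F [TF ndF Foo]] := sigma_finiteT (@lebesgue_measure R).
have /sigma_finiteP[G [TG ndG Goo]] := sigma_finiteT m.
have mFG k : measurable (F k `*` G k).
  by apply: measurableX; [exact: (Foo k).1|exact: (Goo k).1].
exists (fun k => @rV_uncons n @^-1` (F k `*` G k)).
  apply/esym; rewrite -subTset => v _.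
  have [i _ Fi] : (\bigcup_k F k) (rV_uncons v).1 by rewrite -TF.
  have [j _ Gj] : (\bigcup_k G k) (rV_uncons v).2 by rewrite -TG.
  exists (maxn i j) => //; split.
    by apply: (subsetPset _ _ (ndF _ _ (leq_maxl i j))).
  by apply: (subsetPset _ _ (ndG _ _ (leq_maxr i j))).
move=> k; split; first by rewrite -[X in measurable X]setTI; exact: measurable_rV_uncons.
rewrite /lebesgue_rV_succ /pushforward -comp_preimage.
rewrite (_ : _ @^-1` _ = F k `*` G k); last first.
  by rewrite (_ : _ \o _ = id) //; apply/funext => p; exact: rV_consK.
have [mF Fk] := Foo k; have [mG Gk] := Goo k.
by rewrite product_measure1E// lte_mul_pinfty// ge0_fin_numE.
Qed.

HB.instance Definition _ := Measure_isSigmaFinite.Build _ _ _ lebesgue_rV_succ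
  lebesgue_rV_succ_sigma_finite.
End lebesgue_rV_succ.

Fixpoint lebesgue_rV n : {sigma_finite_measure set 'rV[R]_n -> \bar R} :=
  if n is k.+1 then lebesgue_rV_succ (lebesgue_rV k) else \d_(0 : 'rV[R]_0).

Lemma lebesgue_rV_box n (a b : 'rV[R]_n) : (forall i, a ord0 i <= b ord0 i) ->
  lebesgue_rV n [set x | forall i, a ord0 i <= x ord0 i <= b ord0 i] =
  (\prod_(i < n) (b ord0 i - a ord0 i))%:E.
Proof.
elim: n a b => [|n IHn] a b ab.
  rewrite big_ord0 /= diracE mem_set//= => -[]//.
pose B := [set x : 'rV[R]_n |
  forall i, (rV_uncons a).2 ord0 i <= x ord0 i <= (rV_uncons b).2 ord0 i].
have mB : measurable B.
  rewrite (_ : B = \bigcap_(i : 'I_n) ((fun x : 'rV[R]_n => x ord0 i) @^-1`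
      `[(rV_uncons a).2 ord0 i, (rV_uncons b).2 ord0 i]%classic)).
    apply: fin_bigcap_measurable => // i _; rewrite -[X in measurable X]setTI.
    by apply: measurable_coord => //; exact: measurable_itv.
  apply/seteqP; split => x /= h i; first by move=> _; rewrite /= in_itv/=; exact: h.
  by have := h i I; rewrite /= in_itv/=.
transitivity ((lebesgue_measure \x lebesgue_rV n)%E
    (`[a ord0 ord0, b ord0 ord0]%classic `*` B)).
  set A := (X in lebesgue_rV n.+1 X).
  rewrite -[LHS]/((lebesgue_measure \x lebesgue_rV n)%E (@rV_cons n @^-1` A)).
  congr (product_measure1 _ _ _).
  apply/seteqP; split => -[t x] /=.
    move=> h; split; first by have := h ord0; rewrite rV_cons0 in_itv.
    by move=> i; have := h (lift ord0 i); rewrite rV_consS !mxE.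
  rewrite in_itv/= => -[h1 h2] i; have [j ->|->] := unliftP ord0 i.
    by have := h2 j; rewrite rV_consS !mxE.
  by rewrite rV_cons0.
rewrite product_measure1E//.
have -> : lebesgue_rV n B = (\prod_(i < n)
    (b ord0 (lift ord0 i) - a ord0 (lift ord0 i)))%:E.
  rewrite IHn => [|i]; last by rewrite !mxE.
  by congr EFin; apply: eq_bigr => i _; rewrite !mxE.
rewrite big_ord_recl EFinM; congr (_ * _)%E.
rewrite [LHS](@lebesgue_measure_itv R `[a ord0 ord0, b ord0 ord0])/= lte_fin.
case: ltP => // ba; have := ab ord0; rewrite le_eqVlt ltNge ba orbF.
by move=> /eqP ->; rewrite subrr.
Qed.

End lebesgue_measure_rV.

Import Quotient.Exports.

Section L1_space.
Context d {T : measurableType d} {R : realType}.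
Variable mu : {measure set T -> \bar R}.

Local Notation Lfun1 := (LfunType mu (lexx 1%E)).

Definition L1_null : {pred Lfun1} := [pred f : Lfun1 | `[< (f : T -> R) = cst 0 %[ae mu] >]].

Lemma L1_nullP (f : Lfun1) : reflect ((f : T -> R) = cst 0 %[ae mu]) (f \in L1_null).
Proof. exact: asboolP. Qed.

Lemma L1_null_zmod_closed : zmod_closed L1_null.
Proof.
split=> [|f g /L1_nullP f0 /L1_nullP g0]; apply/L1_nullP.
  by apply: aeW.
by apply: filterS2 f0 g0 => x f0 g0 xT; rewrite -[LHS]/(f x - g x) f0// g0//= subrr.
Qed.

HB.instance Definition _ := GRing.isZmodClosed.Build _ L1_null
  L1_null_zmod_closed.

Definition L1 : Type := Quotient.quot L1_null.

HB.instance Definition _ := Choice.on L1.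
HB.instance Definition _ := GRing.Zmodule.on L1.

Definition L1_pi : Lfun1 -> L1 := \pi_(Quotient.quot L1_null)%qT.

Lemma L1_piP (f g : Lfun1) :
  L1_pi f = L1_pi g <-> (f : T -> R) = g %[ae mu].
Proof.
have -> : (L1_pi f = L1_pi g) <-> (f - g \in L1_null).
  rewrite Quotient.idealrBE; split => [/eqP//|/eqP]; exact.
split => [/L1_nullP fg|fg].
  apply: filterS fg => x fg xT; apply/eqP; rewrite -subr_eq0.
  by apply/eqP; exact: fg.
apply/L1_nullP; apply: filterS fg => x fg xT.
by rewrite -[LHS]/(f x - g x) fg// subrr.
Qed.

Definition L1_repr (u : L1) : Lfun1 := repr (u : Quotient.quot L1_null).

Lemma L1_reprK u : L1_pi (L1_repr u) = u.
Proof. exact: reprK. Qed.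

Lemma L1_pi_repr f : (L1_repr (L1_pi f) : T -> R) = f %[ae mu].
Proof. by apply/L1_piP; rewrite L1_reprK. Qed.

Lemma L1_piD : {morph L1_pi : f g / f + g}.
Proof. exact: Quotient.pi_add. Qed.

Definition L1_scale (a : R) (u : L1) : L1 := L1_pi (a *: L1_repr u).

Lemma L1_pi_scale a f : L1_scale a (L1_pi f) = L1_pi (a *: f).
Proof.
apply/L1_piP; apply: filterS (L1_pi_repr f) => x fx xT.
by rewrite -[LHS]/(a * L1_repr (L1_pi f) x) fx.
Qed.

Let L1_scaleA a b u : L1_scale a (L1_scale b u) = L1_scale (a * b) u.
Proof. by rewrite -(L1_reprK u) !L1_pi_scale scalerA. Qed.

Let L1_scale1 : left_id 1 L1_scale.
Proof. by move=> u; rewrite -(L1_reprK u) !L1_pi_scale scale1r. Qed.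

Let L1_scaleDr : right_distributive L1_scale +%R.
Proof.
move=> a u v; rewrite -(L1_reprK u) -(L1_reprK v).
by rewrite -L1_piD !L1_pi_scale scalerDr L1_piD.
Qed.

Let L1_scaleDl u : {morph L1_scale^~ u : a b / a + b}.
Proof.
by move=> a b; rewrite -(L1_reprK u) !L1_pi_scale scalerDl L1_piD.
Qed.

HB.instance Definition _ := GRing.Zmodule_isLmodule.Build R L1
  L1_scaleA L1_scale1 L1_scaleDr L1_scaleDl.

Lemma L1_pi_is_linear : linear L1_pi.
Proof. by move=> a f g; rewrite L1_piD -L1_pi_scale. Qed.

HB.instance Definition _ :=
  GRing.isLinear.Build R Lfun1 L1 *:%R L1_pi L1_pi_is_linear.

Definition L1_norm (u : L1) : R := fine ('N[mu]_1[EFin \o L1_repr u])%E.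

Lemma L1_norm_pi f : L1_norm (L1_pi f) = fine (\int[mu]_x `|f x|%:E)%E.
Proof.
rewrite /L1_norm Lnorm1; congr fine; apply: ae_eq_integral => //.
- by apply/measurable_EFinP; apply: measurableT_comp.
- by apply/measurable_EFinP; apply: measurableT_comp.
- by apply: filterS (L1_pi_repr f) => x fx xT; rewrite /= fx.
Qed.

Let L1_normE f : L1_norm (L1_pi f) = fine ('N[mu]_1[EFin \o f])%E.
Proof. by rewrite L1_norm_pi Lnorm1. Qed.

Let ler_L1_normD u v : L1_norm (u + v) <= L1_norm u + L1_norm v.
Proof.
rewrite -(L1_reprK u) -(L1_reprK v) -L1_piD !L1_normE.
exact: ler_LnormD.
Qed.

Let L1_normZ a u : L1_norm (a *: u) = `|a| * L1_norm u.
Proof.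
rewrite -(L1_reprK u) -[a *: _]/(L1_scale _ _) L1_pi_scale !L1_normE.
apply: EFin_inj; rewrite EFinM !finite_norm_fine; exact: LnormZ.
Qed.

Let L1_norm_eq0 u : L1_norm u = 0 -> u = 0.
Proof.
rewrite -(L1_reprK u) L1_normE => /fine_Lnormr_eq0 u0.
have <- : L1_pi 0 = 0 by exact: linear0.
by apply/L1_piP.
Qed.

HB.instance Definition _ := @Lmodule_isNormed.Build R L1 L1_norm
  ler_L1_normD L1_normZ L1_norm_eq0.

Lemma L1_pi_normE f : `|L1_pi f| = fine (\int[mu]_x `|f x|%:E)%E.
Proof. exact: L1_norm_pi. Qed.

Definition L1_class (g : T -> R) : L1 :=
  if insub g is Some f then L1_pi f else 0.

Lemma L1_classE (f : Lfun1) : L1_class f = L1_pi f.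
Proof. by rewrite /L1_class valK. Qed.

End L1_space.
Arguments L1 {d T R} mu.

Section CL_space.
Context {R : realType} {n : nat}.
Local Notation V := 'rV[R]_n.
Local Notation leb := (@lebesgue_rV R n).

Definition CL_pred : {pred V -> R} := mem [set f |
  [/\ continuous f, bounded_fun f & leb.-integrable setT (EFin \o f)]].

Lemma CL_predP (f : V -> R) : reflect
  [/\ continuous f, bounded_fun f & leb.-integrable setT (EFin \o f)]
  (f \in CL_pred).
Proof. by apply: (iffP idP) => [/set_mem|?]; [|exact: mem_set]. Qed.

Lemma bounded_fun_rVP (f : V -> R) :
  bounded_fun f <-> exists M, forall x, `|f x| <= M.
Proof.
split=> [[M [Mr h]]|[M h]].
  by exists (M + 1) => x; apply: (h (M + 1)) => //; rewrite ltrDl.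
exists M; split => [|N MN x _]; first exact: num_real.
exact: le_trans (h x) (ltW MN).
Qed.

Lemma CL_submod_closed : submod_closed CL_pred.
Proof.
split.
  apply/CL_predP; split; first exact: cst_continuous.
    by apply/bounded_fun_rVP; exists 0 => x; rewrite normr0.
  exact: integrable0.
move=> a f g /CL_predP[cf /bounded_fun_rVP[M fM] intf].
move=> /CL_predP[cg /bounded_fun_rVP[N gN] intg]; apply/CL_predP; split.
- have -> : a *: f + g = (fun x => a * f x + g x) by [].
  by move=> x; exact: (cvgD (cvgM (cvg_cst a) (cf x)) (cg x)).
- apply/bounded_fun_rVP; exists (`|a| * M + N) => x.
  by apply: le_trans (ler_normD _ _) _; rewrite normrM lerD// ler_wpM2l.
- rewrite [X in integrable _ _ X](_ : _ =
    (fun x => a%:E * (EFin \o f) x + (EFin \o g) x)%E)//.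
  by apply: integrableD => //; exact: integrableZl.
Qed.

HB.instance Definition _ := GRing.isSubmodClosed.Build _ _ CL_pred
  CL_submod_closed.

Record CL := MkCL { CL_fun :> V -> R ; CL_funP : CL_fun \in CL_pred }.

HB.instance Definition _ := [isSub for CL_fun].
HB.instance Definition _ := [Choice of CL by <:].
HB.instance Definition _ := [SubChoice_isSubLmodule of CL by <:].

Definition CL_norm (f : CL) : R :=
  sup (range (fun x => `|f x|)) + \int[leb]_x `|f x|.

Let CLD (f g : CL) x : (f + g) x = f x + g x. Proof. by []. Qed.
Let CLZ a (f : CL) x : (a *: f) x = a * f x. Proof. by []. Qed.

Let CL_has_sup (f : CL) : has_sup (range (fun x => `|f x|)).
Proof.
split; first by exists `|f 0|; exists 0.
have /CL_predP[_ /bounded_fun_rVP[M fM] _] := CL_funP f.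
by exists M => _ [x _ <-].
Qed.

Let CL_le_sup (f : CL) x : `|f x| <= sup (range (fun x => `|f x|)).
Proof. by apply: ub_le_sup; [exact: (CL_has_sup f).2|exists x]. Qed.

Let CL_int_abs (f : CL) : leb.-integrable setT (fun x => `|f x|%:E).
Proof.
have /CL_predP[_ _ intf] := CL_funP f; exact: integrable_abse intf.
Qed.

Let ler_CL_normD f g : CL_norm (f + g) <= CL_norm f + CL_norm g.
Proof.
rewrite /CL_norm addrACA lerD//.
  apply: ge_sup; first exact: (CL_has_sup _).1.
  by move=> _ [x _ <-]; apply: le_trans (ler_normD _ _) _; apply: lerD.
rewrite -(RintegralD measurableT (CL_int_abs f) (CL_int_abs g)).
apply: (le_Rintegral measurableT (CL_int_abs (f + g))).
  exact: (integrableD measurableT (CL_int_abs f) (CL_int_abs g)).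
by move=> x _; exact: ler_normD.
Qed.

Let CL_normZ a f : CL_norm (a *: f) = `|a| * CL_norm f.
Proof.
rewrite /CL_norm mulrDr -(RintegralZl _ measurableT (CL_int_abs f)); congr (_ + _); last first.
  by apply: eq_Rintegral => x _; rewrite CLZ normrM.
apply/eqP; rewrite eq_le; apply/andP; split.
  apply: ge_sup; first exact: (CL_has_sup _).1.
  by move=> _ [x _ <-]; rewrite CLZ normrM ler_wpM2l.
have [->|a0] := eqVneq a 0.
  by rewrite normr0 mul0r; apply: le_trans (CL_le_sup _ 0).
rewrite mulrC -ler_pdivlMr ?normr_gt0//.
apply: ge_sup; first exact: (CL_has_sup _).1.
move=> _ [x _ <-]; rewrite ler_pdivlMr ?normr_gt0// mulrC -normrM.
exact: (CL_le_sup (a *: f)).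
Qed.

Let CL_norm_eq0 f : CL_norm f = 0 -> f = 0.
Proof.
move=> /eqP; rewrite paddr_eq0; last 2 first.
- by apply: le_trans (CL_le_sup _ 0).
- by apply: Rintegral_ge0.
move=> /andP[/eqP f0 _]; apply/val_inj/funext => x /=.
by apply/eqP; rewrite -normr_le0 -f0.
Qed.

HB.instance Definition _ := @Lmodule_isNormed.Build R CL CL_norm
  ler_CL_normD CL_normZ CL_norm_eq0.

Lemma CL_normE (f : CL) :
  `|f| = sup (range (fun x => `|f x|)) + \int[leb]_x `|f x|.
Proof. by []. Qed.

End CL_space.
Arguments CL R n : clear implicits.

Definition enorm {R : realType} {n : nat} (u : 'rV[R]_n) : R :=
  Num.sqrt (\sum_(i < n) u ord0 i ^+ 2).

Definition eball {R : realType} {n : nat} (r : R) : set 'rV[R]_n :=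
  [set y | enorm y <= r].

Section markov_process.
Context {R : realType} {n : nat} {d : measure_display} {Omega : measurableType d}.
Local Notation V := 'rV[R]_n.
Implicit Types (P : probability Omega R) (X : R -> Omega -> V)
  (Q : R -> R.-pker V ~> V) (p : R -> V -> V -> R).

Definition past X (s : R) : set (set Omega) :=
  <<s \bigcup_(r in `[0, s]) preimage_set_system setT (X r) measurable >>.

(* Only times [t >= 0] matter for [X], and only times [t > 0] for [Q].
   [markov_property] is the defining identity of the conditional probability
   P(X(s + t) \in B | past X s) = Q_t(X(s), B) a.s. *)
Record homogeneous_markov P X Q (x : V) : Prop := {
  markov_measurable : measurable_fun
    ([set z | (0 : R) <= z.1] : set (measurableTypeR R * Omega))
    (fun z => X z.1 z.2) ;
  markov_start : {ae P, forall w, X 0 w = x} ;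
  chapman_kolmogorov : forall (s t : R) (u : V) (B : set V), 0 < s -> 0 < t ->
    measurable B -> (Q (s + t)%R u B = \int[Q s u]_y Q t y B)%E ;
  markov_property : forall (s t : R) (A : set Omega) (B : set V), 0 <= s -> 0 < t ->
    past X s A -> measurable B ->
    (P (A `&` X (s + t)%R @^-1` B) = \int[P]_(w in A) Q t (X s w) B)%E
}.

Definition transition_density Q p : Prop :=
  forall (t : R) (u : V), 0 < t ->
    measurable_fun setT (p t u) /\
    forall B : set V, measurable B ->
      (Q t u B = \int[lebesgue_rV n]_(y in B) (p t u y)%:E)%E.

Definition gaussian_bounds p (C0 c0 C1 c1 : R) : Prop :=
  forall (t : R) (u y : V), 0 < t ->
    C0 / t `^ (n%:R / 2) * expR (- c0 * (enorm (u - y) ^+ 2 / t)) <= p t u y /\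
    p t u y <= C1 / t `^ (n%:R / 2) * expR (- c1 * (enorm (u - y) ^+ 2 / t)).

(* The integral is a bounded measurable function of [w] for every f in CL, so
   the default branch of [L1_class] is not used there. *)
Definition time_integral P X (f : V -> R) (T : R) : L1 P :=
  L1_class P (fun w => \int[lebesgue_measure]_(t in `[0, T]) f (X t w)).

Definition potential P X (f : CL R n) : L1 P :=
  lim (time_integral P X f T @[T --> +oo]).

End markov_process.

Import HBSimple.

Section vector_measure.
Context {R : realType} {n : nat} {E : normedModType R}.
Local Notation V := 'rV[R]_n.
Implicit Types (mu : set V -> E) (A : set V) (f : V -> R).

Definition bounded_borel A : Prop := measurable A /\ bounded_set A.

(* Only the values of [mu] on bounded Borel sets are meaningful. *)
Definition vector_radon_measure mu : Prop :=
  forall F : (set V)^nat, (forall k, bounded_borel (F k)) -> trivIset setT F ->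
    bounded_borel (\bigcup_k F k) ->
    series (mu \o F) @ \oo --> mu (\bigcup_k F k).

Definition simple_vintegral mu A (s : {sfun V >-> R}) : E :=
  \sum_(c \in range s) c *: mu (A `&` s @^-1` [set c]).

Definition uniform_approx A f : set_system {sfun V >-> R} :=
  filter_from [set e : R | 0 < e]
    (fun e => [set s : {sfun V >-> R} | forall y, A y -> `|f y - s y| <= e]).

Definition is_vintegral mu A f (v : E) : Prop :=
  simple_vintegral mu A @ uniform_approx A f --> v.

Definition is_vintegral_space mu f (v : E) : Prop :=
  exists2 I : E^nat, (forall N, is_vintegral mu (eball N%:R) f (I N)) &
    I @ \oo --> v.

End vector_measure.

(* Main.v *)
From HB Require Import structures.
Require Import Defs.
From mathcomp Require Import all_boot all_order all_algebra.
From mathcomp Require Import all_classical all_reals all_analysis.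
From mathcomp Require Import measurable_realfun.
Import Order.TTheory GRing.Theory Num.Theory.
Import numFieldNormedType.Exports.
Import HBSimple.
Local Open Scope classical_set_scope.
Local Open Scope ring_scope.
Set Implicit Arguments.
Unset Strict Implicit.
Unset Printing Implicit Defensive.

(** The measure is the occupation measure of the path: mu(A) is the total time
    the process spends in A, i.e. the potential of the indicator of A. More
    generally, for a Borel function f which is bounded and Lebesgue integrable,
    let along f be the function (t, w) |-> f (X t w) on [0, +oo[ x Omega. Apart
    from joint measurability, all that is needed about X is the estimate

      int_0^oo E|f (X t)| dt  <=  sup|f| + K * ||f||_{L^1},   K = C1 / (n/2 - 1),

    of lemma [le_integral_along]: up to time 1 the integrand is at most sup|f|,
    and after time 1 the upper Gaussian bound gives p_t(x, y) <= C1 t^(-n/2),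
    whose integral over [1, +oo[ converges exactly because n >= 3.

    Integrating out the time is a linear contraction from L^1(dt x P) to L^1(P)
    ([le_marginal_norm]), which satisfies a dominated convergence theorem
    ([cvg_marginal_dominated]). Hence the potential of f is the class of
    int_0^oo f (X t) dt, it is linear and bounded in f, and dominated
    convergence yields the convergence of the time integrals, the norm
    sigma-additivity of the occupation measure ([vector_radon_occupation]), and
    the passage from balls to the whole space in the representation
    ([is_vintegral_space_occupation]). On a ball the representation is the
    same estimate applied to f - s, where s is a simple function uniformly
    close to f.

    Uniqueness ([eq_vmeasure]) is a statement on vector measures with values in
    any normed space; norm sigma-additivity alone carries its proof. Let g be
    continuous with U = {g > 0} bounded, and let f_r = min(1, max(0, g / r)).
    By the layer-cake formula ([vintegral_layer_cake]) the integral of f_r is a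
    limit of averages of the values nu{g >= t} with 0 < t <= r. By sigma-additivity those values are
    within e of nu(U) as soon as r is small ([vmeasure_superlevel]), so nu(U) is
    within e of the integral of f_r, which belongs to CL. Two representing
    measures thus agree on the bounded sets {g > 0}; these are stable under
    intersection and include the balls, so Dynkin's theorem concludes. *)

(** * Integrating out one variable as a contraction between L1 spaces *)

Section L1_class.
Context d {T : measurableType d} {R : realType}.
Variable mu : {measure set T -> \bar R}.
Implicit Types f g : T -> R.

(** [L1_class] is defined by cases on membership in L^1; this is its only
    elimination used below, so that the default branch never shows up. *)
Lemma L1_class_lift f : f \in Lfun mu 1 ->
  exists2 F : LfunType mu (lexx 1%E), (F : T -> R) = f & L1_class mu f = L1_pi F.
Proof.
move=> Lf; exists (Lfun_Sub (lexx 1%E) Lf); first exact: Lfun_valP.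
by rewrite -[in LHS](Lfun_valP (lexx 1%E) Lf) L1_classE.
Qed.

Lemma L1_class_ae_eq f g : f \in Lfun mu 1 -> g \in Lfun mu 1 ->
  f = g %[ae mu] -> L1_class mu f = L1_class mu g.
Proof.
move=> /L1_class_lift[F <- ->] /L1_class_lift[G <- ->] FG.
exact/L1_piP.
Qed.

Lemma L1_class_linear a f g : f \in Lfun mu 1 -> g \in Lfun mu 1 ->
  L1_class mu (fun x => a * f x + g x) = a *: L1_class mu f + L1_class mu g.
Proof.
move=> /L1_class_lift[F <- ->] /L1_class_lift[G <- ->].
by rewrite -L1_pi_is_linear -L1_classE.
Qed.

Lemma L1_class_normE f : f \in Lfun mu 1 ->
  (`|L1_class mu f|%:E = \int[mu]_x `|f x|%:E)%E.
Proof.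
move=> Lf; have /Lfun1_integrable/integrableP[mf foo] := Lf.
have [F Ff ->] := L1_class_lift Lf.
by rewrite L1_pi_normE Ff fineK// ge0_fin_numE// integral_ge0.
Qed.

End L1_class.

Section marginal.
Context d1 d2 {T1 : measurableType d1} {T2 : measurableType d2} {R : realType}.
Variables (m1 : {sigma_finite_measure set T1 -> \bar R}).
Variables (m2 : {sigma_finite_measure set T2 -> \bar R}).
Implicit Types h : T1 * T2 -> R.

(** Almost every section of an integrable h is integrable, so that the real
    integral is the genuine one outside a null set, which the class ignores. *)
Definition marginal h : L1 m2 := L1_class m2 (fun y => \int[m1]_x h (x, y)).

Lemma measurable_marginal h : (m1 \x m2)%E.-integrable setT (EFin \o h) ->
  measurable_fun setT (fun y => \int[m1]_x h (x, y)).
Proof.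
by move=> ih; apply: measurableT_comp => //; exact: measurable_fubini_G ih.
Qed.

(** The triangle inequality for the inner integral, then Tonelli. *)
Lemma le_integral_marginal h : (m1 \x m2)%E.-integrable setT (EFin \o h) ->
  (\int[m2]_y `|\int[m1]_x h (x, y)|%:E <= \int[m1 \x m2]_z `|h z|%:E)%E.
Proof.
move=> ih; have mh := measurable_int _ ih.
have mnh : measurable_fun setT (fun z => `|h z|%:E).
  by apply/measurable_EFinP; apply: measurableT_comp => //; exact/measurable_EFinP.
rewrite fubini_tonelli2//.
apply: ge0_le_integral => //.
- apply/measurable_EFinP; apply: measurableT_comp => //.
  exact: measurable_marginal.
- exact: measurable_fun_fubini_tonelli_G.
- move=> y _; rewrite -[leLHS]/(`|(fine (\int[m1]_x (h (x, y))%:E))%:E|)%E.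
  apply: (@le_trans _ _ `|\int[m1]_x (h (x, y))%:E|%E).
    by case: (\int[m1]_x _)%E => [r| |] //=; rewrite normr0 leey.
  apply: le_abse_integral => //.
  exact: (measurableT_comp mh (measurable_pair2 y)).
Qed.

Lemma marginal_Lfun h : (m1 \x m2)%E.-integrable setT (EFin \o h) ->
  (fun y => \int[m1]_x h (x, y)) \in Lfun m2 1.
Proof.
move=> ih; apply/Lfun1_integrable/integrableP; split.
  by apply/measurable_EFinP; exact: measurable_marginal.
apply: le_lt_trans (le_integral_marginal ih) _.
by have /integrableP[] := ih.
Qed.

(** Linearity is only almost sure: it holds at every y for which both sections
    are integrable. *)
Lemma marginal_linear a h k :
  (m1 \x m2)%E.-integrable setT (EFin \o h) ->
  (m1 \x m2)%E.-integrable setT (EFin \o k) ->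
  marginal (fun z => a * h z + k z) = a *: marginal h + marginal k.
Proof.
move=> ih ik; rewrite -L1_class_linear; [|exact: marginal_Lfun..].
have iak : (m1 \x m2)%E.-integrable setT (EFin \o (fun z => a * h z + k z)).
  rewrite [X in integrable _ _ X](_ : _ =
    (fun z => a%:E * (EFin \o h) z + (EFin \o k) z)%E)//.
  by apply: integrableD => //; exact: integrableZl.
apply: L1_class_ae_eq.
- exact: marginal_Lfun iak.
- have [F Fh _] := L1_class_lift (marginal_Lfun ih).
  have [G Gk _] := L1_class_lift (marginal_Lfun ik).
  rewrite [X in X \in _](_ : _ = (a *: F + G : LfunType m2 (lexx 1%E)) :> (T2 -> R)).
    exact: LfunP.
  by apply/funext => y; rewrite -[RHS]/(a * F y + G y) Fh Gk.
- have := ae_integrable2 ih; have := ae_integrable2 ik.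
  apply: filterS2 => y iky ihy _ /=.
  rewrite RintegralD//; last exact: (integrableZl measurableT a ihy).
  by rewrite RintegralZl.
Qed.

Lemma le_marginal_norm h : (m1 \x m2)%E.-integrable setT (EFin \o h) ->
  (`|marginal h|%:E <= \int[m1 \x m2]_z `|h z|%:E)%E.
Proof.
move=> ih; rewrite L1_class_normE; last exact: marginal_Lfun.
exact: le_integral_marginal.
Qed.

Lemma marginalB h k :
  (m1 \x m2)%E.-integrable setT (EFin \o h) ->
  (m1 \x m2)%E.-integrable setT (EFin \o k) ->
  marginal h - marginal k = marginal (fun z => h z - k z).
Proof.
move=> ih ik; rewrite addrC -scaleN1r -marginal_linear//; congr marginal.
by apply/funext => z; rewrite mulN1r addrC.
Qed.

(** The contraction turns the L^1 form of dominated convergence on the product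
    into norm convergence of the classes. *)
Lemma cvg_marginal_dominated (h_ : (T1 * T2 -> R)^nat) h g :
  (forall k, measurable_fun setT (h_ k)) -> measurable_fun setT h ->
  (forall z, h_ ^~ z @ \oo --> h z) ->
  (m1 \x m2)%E.-integrable setT (EFin \o g) ->
  (forall k z, `|h_ k z| <= g z) ->
  marginal \o h_ @ \oo --> marginal h.
Proof.
move=> mh_ mh h_h ig h_g.
have [|||||ih h_h1 _] := @dominated_convergence _ _ _ (m1 \x m2)%E setT measurableT
  (fun k => EFin \o h_ k) (EFin \o h) (EFin \o g).
- by move=> k; exact/measurable_EFinP.
- exact/measurable_EFinP.
- by apply: aeW => z _; apply: cvg_EFin (h_h z); apply: nearW.
- exact: ig.
- by apply: aeW => z k _ /=; rewrite lee_fin.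
have ih_ k : (m1 \x m2)%E.-integrable setT (EFin \o h_ k).
  apply: le_integrable ig => //; first exact/measurable_EFinP.
  by move=> z _ /=; rewrite lee_fin (le_trans (h_g k z))// ler_norm.
apply/subr_cvg0/norm_cvg0P.
apply: (@fine_cvg _ _ _ _ (fun k => `|marginal (h_ k) - marginal h|%:E) 0).
apply: squeeze_cvge h_h1; last exact: cvg_cst.
apply: nearW => k; rewrite lee_fin normr_ge0/=.
rewrite marginalB//; apply: le_trans (le_marginal_norm _) _ => //.
rewrite [X in integrable _ _ X](_ : _ = ((EFin \o h_ k) \- (EFin \o h))%E)//.
exact: (integrableB measurableT (ih_ k) ih).
Qed.

End marginal.

(** * Comparison of measures, and the tail of a power *)

Section measure_comparison.
Context d {T : measurableType d} {R : realType}.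
Local Open Scope ereal_scope.
Import HBNNSimple.

(** The integral of a nonnegative function is the supremum of the integrals of
    the nonnegative simple functions below it, and these are monotone in the
    measure term by term. *)
Lemma le_measure_integral (m1 m2 : {measure set T -> \bar R}) (f : T -> \bar R) :
  (forall A, measurable A -> m1 A <= m2 A) -> (forall x, 0 <= f x) ->
  \int[m1]_x f x <= \int[m2]_x f x.
Proof.
move=> m12 f0; rewrite !ge0_integralTE//.
apply: ge_ereal_sup => _ [h hf <-].
apply: (@le_trans _ _ (sintegral m2 h)); last by apply: ereal_sup_ubound; exists h.
rewrite !sintegralE; apply: lee_fsum => // r rh.
have [r0|r0] := ltP r 0%R; last by rewrite lee_wpmul2l// ?lee_fin// m12.
suff -> : (h @^-1` [set r])%classic = set0 by rewrite !measure0 !mule0.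
by apply/seteqP; split => // x /= hx; move: r0; rewrite -hx ltNge fun_ge0.
Qed.

End measure_comparison.

Section power_tail.
Context {R : realType}.

Lemma powR_cvgy0 (b : R) : 0 < b -> t `^ (- b) @[t --> +oo] --> 0.
Proof.
move=> b0; apply/cvgr0Pnorm_lep; near=> e => /=.
have e0 : 0 < e by near: e; exact: nbhs_right_gt.
near=> t.
have et : e^-1 `^ b^-1 <= t by near: t; apply: nbhs_pinfty_ge; exact: num_real.
have t0 : 0 < t by apply: lt_le_trans et; rewrite powR_gt0// invr_gt0.
rewrite ger0_norm ?powR_ge0// powRN invf_ple ?posrE ?powR_gt0//.
have /(ge0_ler_powR (ltW b0)) := et.
rewrite -powRrM mulVf ?gt_eqF// powRr1 ?invr_ge0 ?(ltW e0)//; apply.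
  by rewrite nnegrE powR_ge0.
by rewrite nnegrE ltW.
Unshelve. all: by end_near. Qed.

(** The primitive is - t^(1 - a) / (a - 1), which vanishes at infinity. *)
Lemma integral_powR_tail (a : R) : 1 < a ->
  (\int[lebesgue_measure]_(t in `[1%R, +oo[) (t `^ (- a))%:E = ((a - 1)^-1)%:E)%E.
Proof.
move=> a1; have a10 : 0 < a - 1 by rewrite subr_gt0.
pose F (t : R) := - (a - 1)^-1 * t `^ (- (a - 1)).
have dF (t : R) : 0 < t -> is_derive t 1 F (t `^ (- a)).
  move=> t0; have dp := is_derive1_powR (- (a - 1)) t0.
  rewrite /F; apply: is_derive_eq.
  rewrite /GRing.scale/= mulrA mulrNN mulVf ?gt_eqF// mul1r.
  by rewrite opprB addrAC subrr add0r.
have cp (t : R) : 0 < t -> {for t, continuous (fun t => t `^ (- a))}.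
  move=> t0; apply: differentiable_continuous; apply/derivable1_diffP.
  by have [] := is_derive1_powR (- a) t0.
rewrite (@ge0_continuous_FTC2y _ _ F 1 0).
- by rewrite /F powR1 mulr1 sub0e -EFinN opprK.
- by move=> t _; exact: powR_ge0.
- apply: continuous_in_subspaceT => t; rewrite inE/= in_itv/= andbT => t1.
  by apply: cp; exact: lt_le_trans t1.
- rewrite -[X in _ --> X](mulr0 (- (a - 1)^-1)).
  by apply: cvgMr; exact: powR_cvgy0.
- by move=> t t1; have [] := dF _ (lt_trans ltr01 t1).
- apply: cvg_at_right_filter; apply: differentiable_continuous.
  by apply/derivable1_diffP; have [] := dF _ ltr01.
- move=> t; rewrite in_itv/= andbT => t1; rewrite derive1E.
  by have [_ ->] := dF _ (lt_trans ltr01 t1).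
Qed.

End power_tail.

(** * Bounded Borel sets and bounded integrable functions *)

Section bounded_borel.
Context {R : realType} {n : nat}.
Local Notation V := 'rV[R]_n.
Implicit Types (A B : set V) (y : V).

Lemma ler_coord_norm y i : `|y ord0 i| <= `|y|.
Proof.
rewrite -[leRHS]/(mx_norm y) mx_normrE.
exact: (le_bigmax _ (fun ij : 'I_1 * 'I_n => `|y ij.1 ij.2|) (ord0, i)).
Qed.

Lemma bounded_rVP A : bounded_set A <-> exists M, forall y, A y -> `|y| <= M.
Proof.
split=> [[M [Mr h]]|[M h]].
  by exists (M + 1) => y Ay; apply: (h (M + 1)) => //; rewrite ltrDl.
exists M; split => [|N MN y Ay]; first exact: num_real.
exact: le_trans (h y Ay) (ltW MN).
Qed.

Lemma bounded_borelS A B : measurable A -> A `<=` B -> bounded_borel B ->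
  bounded_borel A.
Proof.
move=> mA AB [_ /bounded_rVP[M BM]]; split => //.
by apply/bounded_rVP; exists M => y /AB/BM.
Qed.

Lemma measurable_norm_le r : measurable [set y : V | `|y| <= r].
Proof.
have mnorm : measurable_fun setT (fun y : V => `|y|).
  by apply: continuous_measurable_rV; exact: norm_continuous.
have := mnorm measurableT _ (measurable_itv `]-oo, r]).
by rewrite setTI; congr measurable; apply/seteqP; split => y; rewrite /= in_itv.
Qed.

(** A bounded set lies in a cube, which is a closed ball of the sup norm. *)
Lemma lebesgue_rV_bounded A : bounded_borel A -> (lebesgue_rV n A < +oo)%E.
Proof.
move=> [mA /bounded_rVP[M AM]].
pose r := Num.max M 0.
have r0 : 0 <= r by rewrite /r le_max lexx orbT.
pose cube : set V := [set y | forall i, (const_mx (- r) : V) ord0 i <= y ord0 i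
  <= (const_mx r : V) ord0 i].
have cubeE : [set y : V | `|y| <= r] = cube.
  apply/seteqP; split => y /= h.
    by move=> i; rewrite !mxE -ler_norml; exact: le_trans (ler_coord_norm _ _) h.
  rewrite -[leLHS]/(mx_norm y) mx_normrE; apply: bigmax_le => // -[j i] _ /=.
  by rewrite ord1 ler_norml; have := h i; rewrite !mxE.
apply: (@le_lt_trans _ _ (lebesgue_rV n cube)).
  rewrite -cubeE; apply: le_measure; rewrite ?inE//; first exact: measurable_norm_le.
  by move=> y /AM /= h; rewrite (le_trans h)// le_max lexx.
rewrite lebesgue_rV_box ?ltry// => i; rewrite !mxE.
by rewrite -subr_ge0 opprK addr_ge0.
Qed.

Lemma enorm_ge0 y : 0 <= enorm y. Proof. exact: sqrtr_ge0. Qed.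

Lemma ler_norm_enorm y : `|y| <= enorm y.
Proof.
rewrite -[leLHS]/(mx_norm y) mx_normrE; apply: bigmax_le => [|[j i] _ /=].
  exact: enorm_ge0.
rewrite ord1 -sqrtr_sqr ler_wsqrtr// (bigD1 i)//= lerDl.
by apply: sumr_ge0 => k _; exact: sqr_ge0.
Qed.

(** With [ler_norm_enorm], boundedness for the sup norm and for the Euclidean
    norm of [eball] coincide. *)
Lemma ler_enorm_norm y : enorm y <= Num.sqrt n%:R * `|y|.
Proof.
rewrite -[`|y|]ger0_norm// -sqrtr_sqr -sqrtrM// ler_wsqrtr//.
rewrite mulr_natl -[X in _ *+ X](card_ord n) -sumr_const; apply: ler_sum => i _.
by rewrite -(real_normK (num_real (y ord0 i))) lerXn2r ?nnegrE// ler_coord_norm.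
Qed.

Lemma measurable_eball r : measurable (eball r : set V).
Proof.
have msum : measurable_fun setT (fun y : V => \sum_(i < n) y ord0 i ^+ 2).
  by apply: measurable_sum => i; apply: measurable_funX; exact: measurable_coord.
have [r0|r0] := ltP r 0.
  rewrite (_ : eball r = set0)//; apply/seteqP; split => // y /=.
  by rewrite /eball/= => yr; have := lt_le_trans r0 (le_trans (enorm_ge0 y) yr); rewrite ltxx.
have := msum measurableT _ (measurable_itv `]-oo, r ^+ 2]).
rewrite setTI; congr measurable; apply/seteqP; split => y; rewrite /eball/enorm/= in_itv/=.
  by move=> h; rewrite -(ger0_norm r0) -sqrtr_sqr ler_wsqrtr.
have s0 : 0 <= \sum_(i < n) y ord0 i ^+ 2 by apply: sumr_ge0 => k _; exact: sqr_ge0.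
by move=> h; rewrite -(sqr_sqrtr s0) lerXn2r ?nnegrE// sqrtr_ge0.
Qed.

Lemma bounded_borel_eball r : bounded_borel (eball r : set V).
Proof.
split; first exact: measurable_eball.
by apply/bounded_rVP; exists r => y; apply: le_trans; exact: ler_norm_enorm.
Qed.

Lemma sub_eball A : bounded_set A -> \forall N \near \oo, A `<=` eball N%:R.
Proof.
move=> /bounded_rVP[M AM].
near=> N => y Ay; rewrite /eball/=.
apply: le_trans (ler_enorm_norm y) _.
apply: (@le_trans _ _ (Num.sqrt n%:R * M)).
  by rewrite ler_wpM2l// ?sqrtr_ge0//; exact: AM.
by near: N; exact: nbhs_infty_ger.
Unshelve. all: by end_near. Qed.

Implicit Types f g : V -> R.

(** A vector space that contains both CL and the indicators of bounded Borel
    sets, and on which the key estimate [le_integral_along] is finite. *)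
Definition bounded_integrable f := [/\ measurable_fun setT f, bounded_fun f &
  (lebesgue_rV n).-integrable setT (EFin \o f)].

Lemma bounded_integrable_linear a f g : bounded_integrable f ->
  bounded_integrable g -> bounded_integrable (fun y => a * f y + g y).
Proof.
move=> [mf /bounded_fun_rVP[M fM] intf] [mg /bounded_fun_rVP[N gN] intg]; split.
- by apply: measurable_funD => //; apply: measurable_funM.
- apply/bounded_fun_rVP; exists (`|a| * M + N) => y.
  by apply: le_trans (ler_normD _ _) _; rewrite normrM lerD// ler_wpM2l.
- rewrite [X in integrable _ _ X](_ : _ =
    (fun y => a%:E * (EFin \o f) y + (EFin \o g) y)%E)//.
  by apply: integrableD => //; exact: integrableZl.
Qed.

Lemma bounded_integrable_indic f B : measurable_fun setT f -> bounded_fun f ->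
  bounded_borel B -> bounded_integrable (fun y => f y * \1_B y).
Proof.
move=> mf /bounded_fun_rVP[M fM] bB; have [mB _] := bB.
have M0 : 0 <= M by exact: le_trans (fM 0).
have le1 y : `|f y * \1_B y| <= M * \1_B y.
  by rewrite normrM [`|\1_B y|]ger0_norm// ler_wpM2r.
have mfB : measurable_fun setT (fun y => f y * \1_B y).
  by apply: measurable_funM => //; exact: measurable_indic.
split => //.
  apply/bounded_fun_rVP; exists M => y; apply: le_trans (le1 y) _; exact: ler_piMr.
have iB : (lebesgue_rV n).-integrable setT (EFin \o (\1_B : V -> R)).
  apply/integrableP; split; first exact/measurable_EFinP/measurable_indic.
  under eq_integral do rewrite /= ger0_norm//.
  by rewrite integral_indic// setIT lebesgue_rV_bounded.
have iMB := integrableZl measurableT M iB.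
apply: le_integrable iMB => //.
  exact/measurable_EFinP.
by move=> y _; rewrite /= lee_fin (le_trans (le1 y))// ler_norm.
Qed.

Lemma bounded_integrable_indic1 B : bounded_borel B ->
  bounded_integrable (\1_B : V -> R).
Proof.
move=> bB; rewrite (_ : \1_B = (fun y => cst 1 y * \1_B y) :> (V -> R)).
  apply: bounded_integrable_indic => //.
  by apply/bounded_fun_rVP; exists 1 => y; rewrite normr1.
by apply/funext => y /=; rewrite mul1r.
Qed.

Lemma bounded_integrable0 : bounded_integrable (cst 0).
Proof.
split => //; last exact: integrable0.
by apply/bounded_fun_rVP; exists 0 => y; rewrite normr0.
Qed.

End bounded_borel.

(** * The occupation measure of the process *)

Section occupation.
Context {R : realType} {n : nat} {d : measure_display} {Omega : measurableType d}.
Local Notation V := 'rV[R]_n.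
Local Notation leb := (@lebesgue_measure R).
Variables (P : probability Omega R) (X : R -> Omega -> V).
Variables (Q : R -> R.-pker V ~> V) (p : R -> V -> V -> R) (x : V).
Implicit Types f : V -> R.
Hypothesis hX : homogeneous_markov P X Q x.

Let future : set (measurableTypeR R * Omega) := [set z | 0 <= z.1].

Let measurable_future : measurable future.
Proof.
rewrite (_ : future = `[0, +oo[%classic `*` setT).
  by apply: measurableX => //; exact: measurable_itv.
by apply/seteqP; split => z /=; rewrite in_itv/= andbT => // -[].
Qed.

(** The extension by 0 to negative times lets the product of Lebesgue measure
    with P be used unrestricted, while [X] is only measurable on nonnegative
    times. *)
Definition along (f : V -> R) : measurableTypeR R * Omega -> R :=
  (fun z => f (X z.1 z.2)) \_ future.

Lemma alongE f t w : along f (t, w) = if 0 <= t then f (X t w) else 0.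
Proof.
rewrite /along /patch; case: ifPn; first by rewrite inE /future/= => ->.
by rewrite notin_setE /future/= => /negP/negbTE ->.
Qed.

Lemma measurable_along f : measurable_fun setT f -> measurable_fun setT (along f).
Proof.
move=> mf; apply/(measurable_restrictT _ measurable_future).
exact: (measurableT_comp mf (markov_measurable hX)).
Qed.

Lemma measurable_position t : 0 <= t -> measurable_fun setT (X t).
Proof.
move=> t0 _ B mB; rewrite setTI.
have := markov_measurable hX measurable_future mB.
move=> /(measurable_xsection t); rewrite (_ : xsection _ t = X t @^-1` B)//.
apply/seteqP; split => w; rewrite /xsection/= inE; first by case.
by split.
Qed.

Hypothesis hp : transition_density Q p.
Variables (C0 c0 C1 c1 : R).
Hypotheses (hC0 : 0 < C0) (hC1 : 0 < C1) (hc1 : 0 < c1).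
Hypothesis hb : gaussian_bounds p C0 c0 C1 c1.

Lemma density_ge0 t u y : 0 < t -> 0 <= p t u y.
Proof.
move=> t0; have [+ _] := hb u y t0; apply: le_trans.
by rewrite mulr_ge0 ?expR_ge0// divr_ge0 ?powR_ge0// ltW.
Qed.

Lemma le_density t u y : 0 < t -> p t u y <= C1 * t `^ (- (n%:R / 2)).
Proof.
move=> t0; have [_ ub] := hb u y t0; apply: le_trans ub _; rewrite powRN ler_piMr//.
  by rewrite divr_ge0 ?powR_ge0// ltW.
rewrite -expR0 ler_expR mulNr oppr_le0 mulr_ge0 ?(ltW hc1)//.
by rewrite divr_ge0 ?sqr_ge0// ltW.
Qed.

(** The Markov property from time 0, with the sure event as past, identifies
    the law of [X t] with the transition probability from the starting point. *)
Lemma le_law_position t B : 0 < t -> measurable B ->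
  (P (X t @^-1` B) <= (C1 * t `^ (- (n%:R / 2)))%:E * lebesgue_rV n B)%E.
Proof.
move=> t0 mB.
have pT : past X 0 setT by rewrite -setC0; apply: sigma_algebraC; exact: sigma_algebra0.
have := markov_property hX (lexx 0) t0 pT mB.
rewrite setTI add0r => ->.
have mQ : measurable_fun setT (fun w => Q t (X 0 w) B).
  apply: (measurableT_comp (measurable_kernel (Q t) B mB)).
  exact: measurable_position.
rewrite (ae_eq_integral (cst (Q t x B)))//; last first.
  by apply: filterS (markov_start hX) => w /= ->.
rewrite integral_cst// [X in (_ * X)%E](_ : _ = 1%E) ?mule1; last exact: probability_setT.
have [mp ->] := hp x t0; last exact: mB.
rewrite -integral_cst//; apply: ge0_le_integral => //.
- by move=> y _; rewrite lee_fin density_ge0.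
- by apply/measurable_EFinP; exact: measurable_funTS.
- by move=> y _; rewrite lee_fin le_density.
Qed.

(** The law of [X t] is dominated by a multiple of Lebesgue measure. *)
Lemma le_expectation_position t f : 0 < t -> measurable_fun setT f ->
  (\int[P]_w `|f (X t w)|%:E <=
   (C1 * t `^ (- (n%:R / 2)))%:E * \int[lebesgue_rV n]_y `|f y|%:E)%E.
Proof.
move=> t0 mf.
have mXt : isMeasurableFun _ _ _ _ (X t).
  by constructor; exact: measurable_position (ltW t0).
pose Xt : {mfun Omega >-> V} := HB.pack (X t) mXt.
have cge0 : 0 <= C1 * t `^ (- (n%:R / 2)) by rewrite mulr_ge0 ?powR_ge0// ltW.
have mnf : measurable_fun setT (fun y => `|f y|%:E).
  by apply/measurable_EFinP; apply: measurableT_comp.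
have <- : (\int[pushforward P Xt]_y `|f y|%:E = \int[P]_w `|f (X t w)|%:E)%E.
  by rewrite ge0_integral_pushforward.
rewrite -(ge0_integral_mscale _ _ (NngNum cge0))//.
apply: le_measure_integral => //.
move=> A mA; rewrite /mscale/=; exact: le_law_position.
Qed.

Hypothesis hn : (3 <= n)%N.

(** C1 times the integral of t^(-n/2) over [1, +oo[. *)
Definition occupation_constant := C1 / (n%:R / 2 - 1).

Lemma occupation_constant_ge0 : 0 <= occupation_constant.
Proof.
rewrite divr_ge0 ?(ltW hC1)//.
by rewrite subr_ge0 ler_pdivlMr// mul1r ler_nat ltnW.
Qed.

(** The key estimate. Before time 1 the expectation of |f (X t)| is at most M;
    after time 1 it is at most C1 t^(-n/2) times the L^1 norm of f, and this is
    integrable in t since n/2 > 1. *)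
Lemma le_integral_along f M : measurable_fun setT f -> (forall y, `|f y| <= M) ->
  (\int[leb \x P]_z `|along f z|%:E <=
   M%:E + occupation_constant%:E * \int[lebesgue_rV n]_y `|f y|%:E)%E.
Proof.
move=> mf fM.
have M0 : 0 <= M by exact: le_trans (fM 0).
have ma : measurable_fun setT (fun z => `|along f z|%:E).
  apply/measurable_EFinP; apply: measurableT_comp => //; exact: measurable_along.
have n1 : 1 < n%:R / 2 :> R.
  by rewrite ltr_pdivlMr// mul1r ltr_nat.
rewrite fubini_tonelli1//.
set I := (\int[lebesgue_rV n]_y _)%E.
have I0 : (0 <= I)%E by apply: integral_ge0.
pose k (t : R) := (C1 * t `^ (- (n%:R / 2)))%:E.
have k0 t : (0 <= k t)%E by rewrite lee_fin mulr_ge0 ?powR_ge0// ltW.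
(* The two intervals meet at time 1, which is harmless for an upper bound. *)
pose g : R -> \bar R := (cst M%:E) \_ `[0%R, 1%R].
pose h : R -> \bar R := (fun t => I * k t)%E \_ `[1%R, +oo[.
have g0 t : (0 <= g t)%E by rewrite /g /patch; case: ifP; rewrite ?lee_fin.
have h0 t : (0 <= h t)%E by rewrite /h /patch; case: ifP; rewrite ?mule_ge0.
have bound t : (\int[P]_w `|along f (t, w)|%:E <= g t + h t)%E.
  have [t0|t0] := ltP t 0.
    rewrite integral0_eq ?adde_ge0// => w _.
    by rewrite alongE leNgt t0 normr0.
  have [t1|t1] := leP t 1.
    apply: le_trans (leeDl _ (h0 t)).
    rewrite /g /patch mem_set; last by rewrite /= in_itv/= t0.
    rewrite -[leRHS]mule1 -(@probability_setT _ _ _ P) -integral_cst//.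
    apply: ge0_le_integral => //.
      exact: measurableT_comp ma (measurable_pair1 t).
    by move=> w _; rewrite alongE t0 lee_fin.
  apply: le_trans (leeDr _ (g0 t)).
  rewrite /h /patch mem_set; last by rewrite /= in_itv/= ltW.
  rewrite muleC; under eq_integral do rewrite alongE t0.
  by apply: le_expectation_position => //; exact: lt_trans t1.
have mk (D : set R) : measurable_fun D k.
  apply: measurable_funTS; apply/measurable_EFinP.
  by apply: measurable_funM => //; exact: measurable_powR.
have mg : measurable_fun setT g.
  by apply/(measurable_restrictT _ _).1 => //; exact: measurable_itv.
have mh : measurable_fun setT h.
  apply/(measurable_restrictT _ _).1; first exact: measurable_itv.
  by apply: measurable_funeM.
apply: (@le_trans _ _ (\int[leb]_t (g t + h t))%E).
  apply: ge0_le_integral => //.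
  - by move=> t _; apply: integral_ge0.
  - exact: measurable_fun_fubini_tonelli_F.
  - exact: emeasurable_funD.
  - by move=> t _; exact: bound.
rewrite ge0_integralD// -!integral_mkcond integral_cst//.
rewrite ge0_integralZl//.
rewrite (_ : \int[leb]_(t in `[1%R, +oo[) k t = occupation_constant%:E)%E.
  rewrite [X in (_ + X <= _)%E]muleC leeD2r// [X in (_ * X <= _)%E](_ : _ = 1%E) ?mule1//.
  by rewrite [LHS](@lebesgue_measure_itv R `[0, 1])/= lte_fin ltr01 -EFinD subr0.
under eq_integral do rewrite /k EFinM.
rewrite ge0_integralZl_EFin//.
- by rewrite integral_powR_tail.
- by move=> t _; rewrite lee_fin powR_ge0.
- by apply: measurable_funTS; apply/measurable_EFinP; exact: measurable_powR.
- exact: ltW.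
- exact: mk.
Qed.

Lemma integrable_along f : bounded_integrable f ->
  (leb \x P)%E.-integrable setT (EFin \o along f).
Proof.
move=> [mf /bounded_fun_rVP[M fM] /integrableP[_ foo]]; apply/integrableP; split.
  by apply/measurable_EFinP; exact: measurable_along.
apply: le_lt_trans (le_integral_along mf fM) _.
rewrite lte_add_pinfty ?ltry// lte_mul_pinfty// lee_fin.
exact: occupation_constant_ge0.
Qed.

Lemma along_linear a f g :
  along (fun y => a * f y + g y) = (fun z => a * along f z + along g z).
Proof.
by apply/funext => -[t w]; rewrite !alongE; case: ifP; rewrite // mulr0 addr0.
Qed.

Definition occupation f : L1 P := marginal leb P (along f).

Lemma occupation_linear a f g : bounded_integrable f -> bounded_integrable g ->
  occupation (fun y => a * f y + g y) = a *: occupation f + occupation g.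
Proof.
move=> bf bg; rewrite /occupation along_linear marginal_linear//.
- exact: integrable_along.
- exact: integrable_along.
Qed.

Lemma cvg_occupation_dominated (f_ : (V -> R)^nat) f g :
  (forall k, measurable_fun setT (f_ k)) -> measurable_fun setT f ->
  (forall y, f_ ^~ y @ \oo --> f y) -> bounded_integrable g ->
  (forall k y, `|f_ k y| <= g y) ->
  occupation \o f_ @ \oo --> occupation f.
Proof.
move=> mf_ mf f_f bg f_g.
apply: (@cvg_marginal_dominated _ _ _ _ _ leb P (fun k => along (f_ k)) _ (along g)).
- by move=> k; exact: measurable_along.
- exact: measurable_along.
- move=> [t w]; rewrite alongE; case: ifPn => t0.
    under eq_fun do rewrite alongE t0; exact: f_f.
  by under eq_fun do rewrite alongE (negbTE t0); exact: cvg_cst.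
- exact: integrable_along.
- by move=> k [t w]; rewrite !alongE; case: ifP => _ //; rewrite normr0.
Qed.

Lemma le_occupation_norm f M : (forall y, `|f y| <= M) -> bounded_integrable f ->
  `|occupation f| <= M + occupation_constant * \int[lebesgue_rV n]_y `|f y|.
Proof.
move=> fM bf; have [mf _ intf] := bf.
have /integrable_abse iaf := intf.
rewrite -lee_fin EFinD EFinM /Rintegral.
rewrite [X in (_ <= _ + _ * X)%E]fineK; last exact: integrable_fin_num iaf.
apply: le_trans (le_integral_along mf fM).
by apply: le_marginal_norm; exact: integrable_along.
Qed.

Lemma time_integralE f T : time_integral P X f T =
  marginal leb P (fun z => if z.1 <= T then along f z else 0).
Proof.
congr (L1_class _ _); apply/funext => w; rewrite Rintegral_mkcond.
apply: eq_Rintegral => t _ /=; rewrite alongE /patch.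
have -> : (t \in `[0, T]%classic) = (0 <= t) && (t <= T) by rewrite mem_setE in_itv.
by case: (0 <= t); case: (t <= T).
Qed.

(** Along any sequence of times going to infinity the truncated integrands are
    dominated by the full one. *)
Lemma cvg_time_integral f : bounded_integrable f ->
  time_integral P X f T @[T --> +oo] --> occupation f.
Proof.
move=> bf; apply/subr_cvg0/norm_cvg0P/cvg_pinftyP => u uoo.
apply/norm_cvg0P/subr_cvg0.
under eq_fun do rewrite time_integralE.
have iaf := integrable_along bf; have maf := measurable_int _ iaf.
apply: (@cvg_marginal_dominated _ _ _ _ _ leb P
  (fun k z => if z.1 <= u k then along f z else 0) _ (fun z => `|along f z|)).
- move=> k; apply: measurable_fun_ifT => //; last exact/measurable_EFinP.
  exact: measurable_fun_ler.
- exact/measurable_EFinP.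
- move=> z; apply: cvg_near_cst.
  have /cvgryPge/(_ z.1) := uoo.
  by apply: filterS => k ->.
- exact: integrable_abse iaf.
- by move=> k z; case: ifP => // _; rewrite normr0.
Qed.

Lemma occupation0 : occupation (cst 0) = 0.
Proof.
have := occupation_linear (-1) bounded_integrable0 bounded_integrable0.
rewrite scaleN1r addNr => <-; congr occupation.
by apply/funext => y /=; rewrite mulr0 addr0.
Qed.

Lemma occupation_sum (I : Type) (s : seq I) (c : I -> R) (f_ : I -> V -> R) :
  (forall i, bounded_integrable (f_ i)) ->
  occupation (fun y => \sum_(i <- s) c i * f_ i y) =
    \sum_(i <- s) c i *: occupation (f_ i).
Proof.
move=> bf; suff [] : bounded_integrable (fun y => \sum_(i <- s) c i * f_ i y) /\
    occupation (fun y => \sum_(i <- s) c i * f_ i y) =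
    \sum_(i <- s) c i *: occupation (f_ i) by [].
elim: s => [|i s [bs IH]].
  rewrite big_nil (_ : (fun y => _) = cst 0).
    by split; [exact: bounded_integrable0|exact: occupation0].
  by apply/funext => y; rewrite big_nil.
rewrite big_cons -IH -occupation_linear// (_ : (fun y => _) =
    (fun y => c i * f_ i y + \sum_(i <- s) c i * f_ i y)).
  by split => //; exact: bounded_integrable_linear.
by apply/funext => y; rewrite big_cons.
Qed.

Definition occupation_measure (B : set V) : L1 P := occupation (\1_B).

(** The partial sums are the potentials of the indicators of the finite unions,
    which increase to the indicator of the whole union and are dominated by it. *)
Lemma vector_radon_occupation : vector_radon_measure occupation_measure.
Proof.
move=> F bF tF bU.
have -> : series (occupation_measure \o F) =
    occupation \o (fun k y => \sum_(i < k) \1_(F i) y).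
  apply/funext => k; rewrite /series/= big_mkord.
  transitivity (\sum_(i < k) 1 *: occupation (\1_(F i))).
    by apply: eq_bigr => i _; rewrite scale1r.
  rewrite -occupation_sum; last by move=> i; exact: bounded_integrable_indic1.
  by congr occupation; apply/funext => y; apply: eq_bigr => i _; rewrite mul1r.
have sumE k y : \sum_(i < k) \1_(F i) y = \1_(\bigcup_(i < k) F i) y :> R.
  have [[i /= ik Fiy]|nFy] := pselect ((\bigcup_(i < k) F i) y); last first.
    rewrite [RHS]indicE memNset// big1// => i _.
    by rewrite indicE memNset// => Fi; apply: nFy; exists i => //=.
  rewrite [RHS]indicE mem_set; last by exists i.
  rewrite (bigD1 (Ordinal ik))//= indicE mem_set// big1 ?addr0// => j ji.
  rewrite indicE memNset// => Fjy; move/eqP: ji; apply; apply/val_inj => /=.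
  by apply: tF => //; exists y.
apply: (@cvg_occupation_dominated _ _ (\1_(\bigcup_k F k))).
- move=> k; under eq_fun do rewrite sumE.
  apply: measurable_indic; apply: bigcup_measurable => i _; exact: (bF i).1.
- by apply: measurable_indic; exact: bU.1.
- move=> y; have [[i _ Fiy]|nFy] := pselect ((\bigcup_i F i) y); last first.
    rewrite indicE memNset//; under eq_fun do rewrite sumE.
    apply: cvg_near_cst; apply: nearW => k; rewrite indicE memNset//.
    by move=> [i _ Fi]; apply: nFy; exists i.
  rewrite indicE mem_set; last by exists i.
  apply: cvg_near_cst; near=> k; rewrite sumE indicE mem_set//; exists i => //=.
  by near: k; exact: nbhs_infty_gt.
- exact: bounded_integrable_indic1.
- move=> k y; rewrite sumE ger0_norm// !indicE ler_nat.
  case: (boolP (y \in \bigcup_(i < k) F i)) => //.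
  by rewrite inE => -[i _ Fi]; rewrite mem_set//; exists i.
Unshelve. all: by end_near. Qed.

Lemma simple_vintegral_occupation (B : set V) (s : {sfun V >-> R}) :
  bounded_borel B -> simple_vintegral occupation_measure B s =
  occupation (fun y => s y * \1_B y).
Proof.
move=> bB; rewrite /simple_vintegral fsbig_finite; last exact: fimfunP.
rewrite -occupation_sum; last first.
  move=> c; apply: bounded_integrable_indic1.
  apply: (bounded_borelS _ _ bB) => //; apply: measurableI; first exact: bB.1.
  exact: measurable_sfunP.
congr occupation; apply/funext => y.
rewrite fimfunE fsbig_finite; last exact: fimfunP.
rewrite big_distrl/=; apply: eq_bigr => c _.
rewrite indicI /= -mulrA; congr (_ * _); exact: mulrC.
Qed.

(** The integral of a simple function s over B is the potential of s 1_B, and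
    by the key estimate |f - s| <= r on B forces the potentials of f 1_B and
    s 1_B to be within r (1 + K |B|). *)
Lemma is_vintegral_occupation f (B : set V) :
  measurable_fun setT f -> bounded_fun f -> bounded_borel B ->
  is_vintegral occupation_measure B f (occupation (fun y => f y * \1_B y)).
Proof.
move=> mf bf bB W /nbhs_ballP[e /= e0 eW].
have [mB _] := bB.
pose l := fine (lebesgue_rV n B).
have l0 : 0 <= l by exact: fine_ge0.
pose K := 1 + occupation_constant * l.
have K0 : 0 < K by rewrite ltr_wpDr// mulr_ge0// occupation_constant_ge0.
(* The factor 2 yields the strict inequality required by an open ball. *)
exists (e / K / 2); first by rewrite /= !divr_gt0.
move=> s fs /=; apply: eW; rewrite -ball_normE/=.
rewrite simple_vintegral_occupation//.
have bsB : bounded_integrable (fun y => s y * \1_B y).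
  by apply: bounded_integrable_indic => //; exact: simple_bounded.
have bfB := bounded_integrable_indic mf bf bB.
rewrite -opprB normrN addrC -scaleN1r -occupation_linear//.
set h := (X in occupation X).
have hB y : `|h y| <= e / K / 2 * \1_B y.
  rewrite /h mulN1r addrC -mulrBl normrM [`|\1_B y|]ger0_norm//.
  rewrite indicE; case: (boolP (y \in B)); last by rewrite !mulr0.
  by rewrite inE !mulr1 distrC => /fs.
have bh : bounded_integrable h by exact: bounded_integrable_linear.
have eK0 : 0 <= e / K / 2 by rewrite !divr_ge0// ltW.
have h1 y : `|h y| <= e / K / 2.
  by apply: le_trans (hB y) _; apply: ler_piMr.
apply: (@le_lt_trans _ _ (e / 2)); last by rewrite gtr_pMr// invf_lt1// ltr1n.
apply: le_trans (le_occupation_norm h1 bh) _.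
have -> : e / 2 = e / K / 2 + occupation_constant * (e / K / 2 * l).
  rewrite mulrCA -[X in X + _]mulr1 -mulrDr -/K mulrAC.
  by rewrite divfK ?gt_eqF.
rewrite lerD2l ler_wpM2l ?occupation_constant_ge0//.
have iB : (lebesgue_rV n).-integrable setT (EFin \o (\1_B : V -> R)).
  by have [] := bounded_integrable_indic1 bB.
have <- : \int[lebesgue_rV n]_y (e / K / 2 * \1_B y) = e / K / 2 * l.
  by rewrite RintegralZl// /Rintegral integral_indic// setIT.
apply: le_Rintegral => //.
- by have [_ _ ih] := bh; exact: integrable_abse ih.
- exact: (integrableZl measurableT (e / K / 2) iB).
Qed.

(** The functions f 1_{B_N} converge to f and are dominated by |f|. *)
Lemma is_vintegral_space_occupation f : bounded_integrable f ->
  is_vintegral_space occupation_measure f (occupation f).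
Proof.
move=> bf; have [mf bdf intf] := bf.
exists (fun N => occupation (fun y => f y * \1_(eball N%:R) y)).
  by move=> N; apply: is_vintegral_occupation => //; exact: bounded_borel_eball.
apply: (@cvg_occupation_dominated _ _ (fun y => `|f y|)).
- move=> N; apply: measurable_funM => //; apply: measurable_indic.
  exact: measurable_eball.
- by [].
- move=> y; apply: cvg_near_cst.
  have /sub_eball : bounded_set [set y] by apply/bounded_rVP; exists `|y| => _ ->.
  by apply: filterS => N yN; rewrite indicE mem_set ?mulr1//; exact: yN.
- split; first exact: measurableT_comp.
    move/bounded_fun_rVP : bdf => [M fM].
    by apply/bounded_fun_rVP; exists M => y; rewrite normr_id.
  exact: integrable_abse intf.
- by move=> N y; rewrite normrM [`|\1_ _ y|]ger0_norm// ler_piMr.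
Qed.

End occupation.

(** * Integrals of ramps against a vector measure *)

Section vector_measure.
Context {R : realType} {n : nat} {E : normedModType R}.
Local Notation V := 'rV[R]_n.
Variable nu : set V -> E.
Hypothesis hnu : vector_radon_measure nu.
Implicit Types A B U : set V.

Lemma bounded_borel0 : bounded_borel (set0 : set V).
Proof. by split => //; apply/bounded_rVP; exists 0. Qed.

Lemma bounded_borelU A B : bounded_borel A -> bounded_borel B ->
  bounded_borel (A `|` B).
Proof.
move=> [mA /bounded_rVP[M AM]] [mB /bounded_rVP[N BN]].
split; first exact: measurableU.
apply/bounded_rVP; exists (Num.max M N) => y [/AM|/BN] h; rewrite le_max h//.
by rewrite orbT.
Qed.

(** The constant sequence of empty sets has a convergent series, whose general
    term must tend to 0. *)
Lemma vmeasure0 : nu set0 = 0.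
Proof.
pose F (k : nat) : set V := set0.
have bF : \bigcup_k F k = set0 by apply: bigcup0.
have nuF : series (nu \o F) @ \oo --> nu set0.
  rewrite -bF; apply: hnu.
  - by move=> k; exact: bounded_borel0.
  - by move=> i j _ _ [y []].
  - by rewrite bF; exact: bounded_borel0.
have /cvg_series_cvg_0 h : cvgn (series (nu \o F)) by apply/cvg_ex; exists (nu set0).
have h0 : nu \o F @ \oo --> nu set0 by apply: cvg_near_cst; exact: nearW.
exact: norm_cvg_unique h0 h.
Qed.

Lemma vmeasureU A B : bounded_borel A -> bounded_borel B -> A `&` B = set0 ->
  nu (A `|` B) = nu A + nu B.
Proof.
move=> bA bB AB0.
have bF k : bounded_borel (bigcup2 A B k).
  by case: k => [|[|k]] //; exact: bounded_borel0.
have tF : trivIset setT (bigcup2 A B) by rewrite -trivIset_bigcup2.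
have := hnu bF tF; rewrite bigcup2E => /(_ (bounded_borelU bA bB)) nuF.
apply/esym; apply: (norm_cvg_unique _ nuF).
apply: cvg_near_cst; near=> k.
have k2 : (2 <= k)%N by near: k; exact: nbhs_infty_ge.
rewrite /series/= -(subnK k2) addn2 big_nat_recl// big_nat_recl//= big1_seq ?addr0//.
by move=> i _; exact: vmeasure0.
Unshelve. all: by end_near. Qed.

Lemma vmeasureD A B : measurable B -> B `<=` A -> bounded_borel A ->
  nu (A `\` B) = nu A - nu B.
Proof.
move=> mB BA bA; have bB := bounded_borelS mB BA bA.
have bD : bounded_borel (A `\` B).
  by apply: (bounded_borelS _ _ bA) => //; apply: measurableD => //; exact: bA.1.
rewrite -{2}(setDUK BA) vmeasureU//; last by rewrite setDIK.
by rewrite addrC addrA addNr add0r.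
Qed.

Lemma cvg_vmeasure_nondecreasing (F : (set V)^nat) :
  (forall k, measurable (F k)) -> nondecreasing_seq F ->
  bounded_borel (\bigcup_k F k) -> nu \o F @ \oo --> nu (\bigcup_k F k).
Proof.
move=> mF ndF bU.
have bF k : bounded_borel (F k).
  by apply: (bounded_borelS _ _ bU) => //; exact: bigcup_sup.
have bD k : bounded_borel (seqD F k).
  case: k => [|k]; first exact: bF.
  apply: (bounded_borelS _ _ (bF k.+1)); first exact: measurableD.
  exact: subDsetl.
have := hnu bD (trivIset_seqD ndF); rewrite eq_bigcup_seqD => /(_ bU).
rewrite -(cvg_shiftS (series _)).
suff -> : (fun k => series (nu \o seqD F) k.+1) = nu \o F by [].
apply/funext => k; rewrite /series/=; elim: k => [|k IH]; first by rewrite big_nat1.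
rewrite big_nat_recr//= IH vmeasureD ?subrKC//.
by apply/subsetPset; exact: ndF.
Qed.

(** The sets {g >= t} increase to {g > 0} as t decreases to 0. Continuity from
    below is available along monotone sequences only, hence the uniform version
    goes by contradiction: bad levels exist below every bound, so they can be
    chosen recursively to form a sequence decreasing to 0. *)
Lemma vmeasure_superlevel (g : V -> R) (e : R) :
  measurable_fun setT g ->
  bounded_borel [set y | 0 < g y] -> 0 < e ->
  exists2 r : R, 0 < r & forall t : R, 0 < t <= r ->
    `|nu [set y | 0 < g y] - nu [set y | t <= g y]| <= e.
Proof.
move=> mg bU e0; apply: contrapT => /forall2NP bad.
have /choice[bad_t bad_tP] : forall r : R, exists t, 0 < r -> 0 < t <= r /\
    e < `|nu [set y | 0 < g y] - nu [set y | t <= g y]|.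
  move=> r; have [r0|r0] := ltP 0 r; last by exists 0.
  have [//|/existsNP[t /not_implyP[tr /negP]]] := bad r.
  by rewrite -ltNge; exists t.
(* The cap 1 / (k + 1) forces the bad levels to tend to 0. *)
pose t_ := fix t_ k := if k is k'.+1 then bad_t (Num.min (t_ k') k.+1%:R^-1)
  else bad_t 1.
have t_gt0 k : 0 < t_ k.
  elim: k => [|k IH] /=; first by have [] := bad_tP 1 ltr01 => /andP[].
  have [|/andP[]//] := bad_tP (Num.min (t_ k) k.+2%:R^-1).
  by rewrite lt_min IH invr_gt0 ltr0n.
have tS k : t_ k.+1 <= Num.min (t_ k) k.+2%:R^-1.
  have [|/andP[]//] := bad_tP (Num.min (t_ k) k.+2%:R^-1).
  by rewrite lt_min t_gt0 invr_gt0 ltr0n.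
have t_bad k : e < `|nu [set y | 0 < g y] - nu [set y | t_ k <= g y]|.
  case: k => [|k] /=; first by have [] := bad_tP 1 ltr01.
  have [|//] := bad_tP (Num.min (t_ k) k.+2%:R^-1).
  by rewrite lt_min t_gt0 invr_gt0 ltr0n.
pose F k := [set y | t_ k <= g y].
have FE : \bigcup_k F k = [set y | 0 < g y].
  apply/seteqP; split => [y [k _]|y /= gy0].
    by rewrite /F/=; exact: lt_le_trans.
  have [k kg] : exists k : nat, k.+2%:R^-1 <= g y.
    exists (Num.truncn (g y)^-1); rewrite invf_ple ?posrE//.
    by apply/ltW/(lt_trans (truncnS_gt _)); rewrite ltr_nat.
  exists k.+1 => //; rewrite /F/=; apply: le_trans (tS k) _.
  by rewrite ge_min kg orbT.
have nuF : nu \o F @ \oo --> nu [set y | 0 < g y].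
  rewrite -FE; apply: cvg_vmeasure_nondecreasing; last by rewrite FE.
    move=> k; have := mg measurableT _ (measurable_itv `[t_ k, +oo[).
    by rewrite setTI; congr measurable; apply/seteqP; split => y; rewrite /F/= in_itv/= andbT.
  apply/nondecreasing_seqP => k; apply/subsetPset => y; rewrite /F/=.
  apply: le_trans; apply: le_trans (tS k) _.
  by rewrite ge_min lexx.
have /cvgrPdist_lt/(_ e e0)[N _ /(_ N (leqnn N))/=] := nuF.
by rewrite ltNge (ltW (t_bad N)).
Qed.

Lemma summation_by_parts (a : nat -> E) m :
  \sum_(j < m.+1) j%:R *: (a j - a j.+1) =
  \sum_(j < m) a j.+1 - (m%:R : R) *: a m.+1.
Proof.
elim: m => [|m IH]; first by rewrite big_ord1 big_ord0 !scale0r subr0.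
rewrite big_ord_recr/= IH [in RHS]big_ord_recr/= -!addrA; congr (_ + _).
rewrite scalerBr addrA; congr (_ - _).
by rewrite -natr1 scalerDl scale1r addrA addNr add0r.
Qed.

(** The simple function is floor(m f) / m. It takes the value j / m on the
    difference of the superlevel sets {m f >= j} and {m f >= j + 1}, and a
    summation by parts replaces the measures of these differences by the
    measures of the superlevel sets themselves. *)
Lemma vintegral_layer_cake (f : V -> R) A m : measurable_fun setT f ->
  (forall y, 0 <= f y <= 1) -> bounded_borel A -> (0 < m)%N ->
  exists2 s : {sfun V >-> R}, forall y, `|f y - s y| <= m%:R^-1 &
    simple_vintegral nu A s = m%:R^-1 *:
      \sum_(j < m) nu (A `&` [set y | j.+1%:R <= m%:R * f y]).
Proof.
move=> mf f01 bA m0.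
have m0R : 0 < m%:R :> R by rewrite ltr0n.
pose U (j : nat) := [set y | j%:R <= m%:R * f y].
have mU j : measurable (U j).
  have mmf : measurable_fun setT (fun y => m%:R * f y) by apply: measurable_funM.
  have := mmf measurableT _ (measurable_itv `[j%:R, +oo[).
  by rewrite setTI; congr measurable; apply/seteqP; split => y; rewrite /U/= in_itv/= andbT.
pose T y := Num.truncn (m%:R * f y).
have mf0 y : 0 <= m%:R * f y by rewrite mulr_ge0//; have /andP[] := f01 y.
have Tm y : (T y < m.+1)%N.
  rewrite truncn_lt_nat// -natr1 ltr_pwDr//.
  by rewrite ler_piMr//; have /andP[] := f01 y.
pose s0 y : R := (T y)%:R / m%:R.
have ms0 : measurable_fun setT s0.
  apply: measurable_funM => //.
  rewrite (_ : (fun y => _) = (fun y => \sum_(j < m) \1_(U j.+1) y)).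
    by apply: measurable_sum => j; exact: measurable_indic.
  apply/funext => y; transitivity (\sum_(j < m) (j < T y)%N%:R : R).
    have {1}-> : T y = (\sum_(j < m | (j < T y)%N) 1)%N.
      by rewrite -(big_ord_widen m (fun=> 1%N)) ?sum1_card ?card_ord// -ltnS.
    by rewrite natr_sum big_mkcond/=; apply: eq_bigr => j _; case: ifP.
  apply: eq_bigr => j _; rewrite indicE; congr (_ %:R); congr nat_of_bool.
  by rewrite /T truncn_gt_nat; apply/idP/idP; rewrite inE.
have fs0 : finite_set (range s0).
  apply: (@sub_finite_set _ _ ((fun j : nat => j%:R / m%:R) @` `I_m.+1)).
    by move=> _ [y _ <-]; exists (T y) => //=.
  by apply: finite_image; exact: finite_II.
have fs0' : FiniteImage _ _ s0 by constructor.
have ms0' : isMeasurableFun _ _ _ _ s0 by constructor.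
pose s : {sfun V >-> R} := HB.pack s0 ms0' fs0'.
exists s.
  move=> y; rewrite -[s y]/(s0 y) /s0.
  have /andP[T1 T2] := truncn_itv (mf0 y).
  rewrite -(ler_pM2l m0R) mulfV ?gt_eqF// -{1}[m%:R]ger0_norm// -normrM mulrBr.
  by rewrite mulrCA mulfV ?gt_eqF// mulr1 ger0_norm ?subr_ge0// lerBlDl natr1 ltW.
have s_pre j : s @^-1` [set j%:R / m%:R] = U j `\` U j.+1.
  apply/seteqP; split => y /=.
    rewrite /s0 => /(mulIf _) h.
    have /h/eqP : (m%:R : R)^-1 != 0 by rewrite invr_eq0 gt_eqF.
    rewrite eqr_nat => /eqP <-.
    have /andP[T1 T2] := truncn_itv (mf0 y).
    by split => //; rewrite /U/=; apply/negP; rewrite -ltNge.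
  rewrite /U/= => -[h1 /negP]; rewrite -ltNge => h2.
  by rewrite /s0 /T (@truncn_def _ _ j)// h1.
have bAU j : bounded_borel (A `&` U j).
  by apply: (bounded_borelS _ _ bA) => //; apply: measurableI => //; exact: bA.1.
have nu_pre j : nu (A `&` s @^-1` [set j%:R / m%:R]) =
    nu (A `&` U j) - nu (A `&` U j.+1).
  rewrite s_pre setIDA -vmeasureD//; last 2 first.
    by apply: measurableI => //; exact: bA.1.
    move=> y [Ay]; rewrite /U/= => h; split => //=; apply: le_trans h.
    by rewrite ler_nat.
  congr nu; apply/seteqP; split => y /= [[Ay Uy] nUy]; split => //.
    by move=> [].
  by move=> UyS; apply: nUy.
rewrite /simple_vintegral.
(* Values j / m that are not attained contribute the measure of the empty set. *)
rewrite (@fsbig_widen _ _ _ _ _ ((fun j : nat => j%:R / m%:R) @` `I_m.+1)); last 2 first.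
- by move=> _ [y _ <-]; exists (T y) => //=.
- move=> c [_ /= nc]; rewrite (_ : _ `&` _ = set0) ?vmeasure0 ?scaler0//.
  by apply/seteqP; split => // y /= [_ yc]; apply: nc; exists y.
rewrite (@reindex_fsbig _ _ _ _ _ (fun j : nat => j%:R / m%:R) `I_m.+1); last first.
  split; [by move=> j jm; exists j|move=> j k _ _ /(mulIf _) h|by []].
  have /h/eqP : (m%:R : R)^-1 != 0 by rewrite invr_eq0 gt_eqF.
  by rewrite eqr_nat => /eqP.
rewrite -fsbig_ord.
under eq_bigr => j _ do rewrite nu_pre mulrC -scalerA.
rewrite -scaler_sumr (summation_by_parts (fun j => nu (A `&` U j))); congr (_ *: _).
rewrite (_ : A `&` U m.+1 = set0) ?vmeasure0 ?scaler0 ?subr0//.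
apply/seteqP; split => // y [_]; rewrite /U/= leNgt => /negP; apply.
by rewrite -truncn_lt_nat//; exact: Tm.
Qed.

Implicit Types (g : V -> R) (r t : R).

(** As r tends to 0 the ramps increase to the indicator of {g > 0}; their
    superlevel sets at levels t in ]0, 1] are the sets {g >= t r}. *)
Definition ramp (g : V -> R) (r : R) y := Num.min 1 (Num.max 0 (g y / r)).

Lemma ramp_itv g r y : 0 <= ramp g r y <= 1.
Proof. by rewrite /ramp le_min ler01 le_max lexx ge_min lexx. Qed.

Lemma le_ramp g r t y : 0 < r -> 0 < t <= 1 -> (t <= ramp g r y) = (t * r <= g y).
Proof.
move=> r0 /andP[t0 t1].
by rewrite /ramp le_min t1 le_max leNgt t0/= ler_pdivlMr.
Qed.

Lemma measurable_ramp g r : measurable_fun setT g -> measurable_fun setT (ramp g r).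
Proof.
move=> mg; apply: measurable_minr => //; apply: measurable_maxr => //.
by apply: measurable_funM.
Qed.

(** For every m, the integral of the layer-cake approximation of the ramp is the
    average of m values nu{g >= t} with t <= r, all within e of nu{g > 0}. *)
Lemma is_vintegral_ramp g r A v (e : R) : measurable_fun setT g -> 0 < r ->
  [set y | 0 < g y] `<=` A -> bounded_borel A ->
  (forall t : R, 0 < t <= r ->
    `|nu [set y | 0 < g y] - nu [set y | t <= g y]| <= e) ->
  is_vintegral nu A (ramp g r) v ->
  `|nu [set y | 0 < g y] - v| <= e.
Proof.
move=> mg r0 gA bA gr hv; apply/ler_addgt0Pr => e1 e10.
have [k /= k0 kv] := hv _ (nbhsx_ballx v _ e10).
pose m := (Num.truncn k^-1).+1.
have mk : m%:R^-1 <= k.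
  by rewrite invf_ple ?posrE// ltW// truncnS_gt.
have [s fs sE] := vintegral_layer_cake (measurable_ramp r mg) (ramp_itv g r)
  bA (ltn0Sn _ : (0 < m)%N).
have /kv /= : forall y, A y -> `|ramp g r y - s y| <= k.
  by move=> y _; exact: le_trans (fs y) mk.
rewrite sE -ball_normE/= => vs.
rewrite -(subrKA (simple_vintegral nu A s)).
apply: le_trans (ler_normD _ _) _; apply: lerD; last by rewrite distrC sE ltW.
rewrite sE.
have -> : nu [set y | 0 < g y] = m%:R^-1 *: \sum_(j < m) nu [set y | 0 < g y].
  by rewrite sumr_const card_ord -[nu _ *+ _]scaler_nat scalerA mulVf ?scale1r// pnatr_eq0.
rewrite -scalerBr -sumrB normrZ ger0_norm// ler_pdivrMl ?ltr0n//.
apply: le_trans (ler_norm_sum _ _ _) _.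
apply: (@le_trans _ _ (\sum_(j < m) e)); last first.
  by rewrite sumr_const card_ord mulr_natl.
apply: ler_sum => j _.
have tj : 0 < (j.+1%:R / m%:R : R) <= 1.
  by rewrite divr_gt0//= ler_pdivrMr// mul1r ler_nat ltn_ord.
rewrite (_ : A `&` _ = [set y | j.+1%:R / m%:R * r <= g y]).
  have /andP[t0 t1] := tj.
  by apply: gr; rewrite mulr_gt0//= ler_piMl// ltW.
apply/seteqP; split => y /=.
  by move=> [_]; rewrite mulrC -ler_pdivrMr// le_ramp.
move=> h; split.
  apply: gA => /=; apply: lt_le_trans h; have /andP[t0 _] := tj.
  exact: mulr_gt0.
by rewrite mulrC -ler_pdivrMr// le_ramp.
Qed.

Lemma is_vintegral_space_ramp g r w (e : R) : measurable_fun setT g -> 0 < r ->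
  bounded_borel [set y | 0 < g y] ->
  (forall t : R, 0 < t <= r ->
    `|nu [set y | 0 < g y] - nu [set y | t <= g y]| <= e) ->
  is_vintegral_space nu (ramp g r) w ->
  `|nu [set y | 0 < g y] - w| <= e.
Proof.
move=> mg r0 bU gr [I_ hI Iw]; apply/ler_addgt0Pr => e1 e10.
near \oo => N.
rewrite -(subrKA (I_ N)); apply: le_trans (ler_normD _ _) _; apply: lerD.
  apply: (is_vintegral_ramp (A := eball N%:R) mg r0) => //.
    by near: N; apply: sub_eball; exact: bU.2.
  exact: bounded_borel_eball.
rewrite distrC; near: N; have /cvgrPdist_le := Iw; exact.
Unshelve. all: by end_near. Qed.

End vector_measure.

(** * A vector measure is determined by the integrals of CL functions *)

Section uniqueness.
Context {R : realType} {n : nat} {E : normedModType R}.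
Local Notation V := 'rV[R]_n.
Implicit Types (g : V -> R) (r : R) (U : set V).

Lemma continuous_ramp g r : continuous g -> continuous (ramp g r).
Proof.
move=> cg y; apply: (@continuous_min _ _ (cst 1) (fun y => Num.max 0 (g y / r))).
  exact: cst_continuous.
apply: (@continuous_max _ _ (cst 0) (fun y => g y / r)); first exact: cst_continuous.
exact: (cvgM (cg y) (cvg_cst r^-1)).
Qed.

Lemma ramp_CL g r : 0 < r -> continuous g -> bounded_borel [set y | 0 < g y] ->
  ramp g r \in CL_pred.
Proof.
move=> r0 cg bU; have mg := continuous_measurable_rV cg.
apply/CL_predP; split; first exact: continuous_ramp.
  by apply/bounded_fun_rVP; exists 1 => y; have /andP[h0 h1] := ramp_itv g r y; rewrite ger0_norm.
have [_ _ iU] := bounded_integrable_indic1 bU.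
apply: le_integrable iU => //; first by apply/measurable_EFinP; exact: measurable_ramp.
move=> y _; rewrite /= lee_fin; have /andP[h0 h1] := ramp_itv g r y.
rewrite !ger0_norm// indicE; have [gy|gy] := ltP 0 (g y).
  by rewrite mem_set.
rewrite /ramp (_ : Num.max 0 _ = 0) ?ge_min ?ler0n ?orbT//.
by apply/max_idPl; rewrite pmulr_lle0// invr_gt0.
Qed.

(** A pi-system of open sets, each approximated from inside by ramps. *)
Definition positivity_set : set (set V) :=
  [set U | exists2 g : V -> R, continuous g & U = [set y | 0 < g y]].

Lemma positivity_setI : setI_closed positivity_set.
Proof.
move=> _ _ [g cg ->] [h ch ->]; exists (fun y => Num.min (g y) (h y)).
  by move=> y; apply: (@continuous_min _ _ g h); [exact: cg|exact: ch].
by apply/seteqP; split => y /=; rewrite lt_min => /andP.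
Qed.

Lemma positivity_set_ball (c : V) r : positivity_set (ball c r).
Proof.
exists (fun y => r - `|c - y|).
  have cn : continuous (fun y : V => `|c - y|).
    move=> y; apply: (@continuous_comp V V R (fun y => c - y) Num.norm).
      apply: (@continuousB _ _ _ (cst c) id); first exact: cst_continuous.
      exact: cvg_id.
    exact: norm_continuous.
  by move=> y; exact: (cvgB (cvg_cst r) (cn y)).
by rewrite -ball_normE; apply/seteqP; split => y /=; rewrite subr_gt0.
Qed.

Lemma measurable_positivity_set U : positivity_set U -> measurable U.
Proof.
move=> [g cg ->]; have := continuous_measurable_rV cg measurableT (measurable_itv `]0, +oo[).
by rewrite setTI; congr measurable; apply/seteqP; split => y; rewrite /= in_itv/= andbT.
Qed.

(** Every open set is a countable union of balls. *)
Lemma measurable_positivityE : @measurable _ V = <<s positivity_set >>.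
Proof.
apply/seteqP; split.
  apply: smallest_sub; first exact: smallest_sigma_algebra.
  move=> U oU; rewrite (open_rV_bigcup oU) bigcup_mkcond.
  apply: (@countable_bigcupT_measurable _ (g_sigma_algebraType positivity_set)).
    exact: countableP.
  move=> q; case: ifPn => // _; apply: sub_sigma_algebra.
  exact: positivity_set_ball.
apply: smallest_sub; first exact: sigma_algebra_measurable.
exact: measurable_positivity_set.
Qed.

Variables nu mu : set V -> E.
Hypotheses (hnu : vector_radon_measure nu) (hmu : vector_radon_measure mu).
Hypothesis numu : forall f : CL R n, exists2 w,
  is_vintegral_space nu f w & is_vintegral_space mu f w.

(** Both values are arbitrarily close to the common integral of a ramp which is
    steep enough for the two measures. *)
Lemma eq_vmeasure_positivity_set U :
  positivity_set U -> bounded_borel U -> nu U = mu U.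
Proof.
move=> [g cg ->] bU; have mg := continuous_measurable_rV cg.
apply/eqP; rewrite -subr_eq0 -normr_le0; apply/ler_addgt0Pr => e e0; rewrite add0r.
have e20 : 0 < e / 2 by rewrite divr_gt0.
have [r r0 nur] := vmeasure_superlevel hnu mg bU e20.
have [s s0 mus] := vmeasure_superlevel hmu mg bU e20.
pose t := Num.min r s; have t0 : 0 < t by rewrite lt_min r0.
have [w nuw muw] := numu (MkCL (ramp_CL t0 cg bU)).
rewrite -(subrKA w) (splitr e); apply: le_trans (ler_normD _ _) _.
rewrite [`|w - _|]distrC; apply: lerD.
  apply: (is_vintegral_space_ramp hnu mg t0 bU _ nuw) => u /andP[u0 ut].
  by apply: nur; rewrite u0 (le_trans ut)// ge_min lexx.
apply: (is_vintegral_space_ramp hmu mg t0 bU _ muw) => u /andP[u0 ut].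
by apply: mus; rewrite u0 (le_trans ut)// ge_min lexx orbT.
Qed.

(** Only bounded sets are measured, so Dynkin's argument is run on the traces on
    a fixed ball containing A, itself a member of the pi-system. *)
Lemma eq_vmeasure A : bounded_borel A -> nu A = mu A.
Proof.
move=> bA; have [mA /bounded_rVP[M AM]] := bA.
pose B : set V := ball 0 (M + 1).
have GB : positivity_set B by exact: positivity_set_ball.
have mB := measurable_positivity_set GB.
have bB : bounded_borel B.
  split => //; apply/bounded_rVP; exists (M + 1) => y.
  by rewrite /B -ball_normE/= sub0r normrN => /ltW.
have bIB C : measurable C -> bounded_borel (C `&` B).
  by move=> mC; apply: (bounded_borelS _ _ bB) => //; exact: measurableI.
have AB : A `&` B = A.
  apply/setIidPl => y /AM yM; rewrite /B -ball_normE/= sub0r normrN.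
  by rewrite (le_lt_trans yM)// ltrDl.
rewrite -AB.
apply: (dynkin_induction (P := fun C => nu (C `&` B) = mu (C `&` B))
  measurable_positivityE positivity_setI).
- by rewrite setTI; exact: eq_vmeasure_positivity_set.
- move=> U GU /=; apply: eq_vmeasure_positivity_set; first exact: positivity_setI.
  by apply: bIB; exact: measurable_positivity_set.
- move=> C mC nC.
  have -> : ~` C `&` B = B `\` (C `&` B).
    by rewrite setDIr setDv setU0 setDE setIC.
  have mCB : measurable (C `&` B) by exact: measurableI.
  rewrite (vmeasureD hnu mCB (@subIsetr _ _ _) bB).
  rewrite (vmeasureD hmu mCB (@subIsetr _ _ _) bB) nC; congr (_ - _).
  exact: eq_vmeasure_positivity_set.
- move=> F mF tF nF; rewrite setI_bigcupl.
  have bF k : bounded_borel (F k `&` B) by exact: bIB.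
  have tFB : trivIset setT (fun k => F k `&` B) by exact: trivIset_setIr.
  have bU : bounded_borel (\bigcup_k (F k `&` B)).
    by rewrite -setI_bigcupl; apply: bIB; exact: bigcup_measurable.
  have := hmu bF tFB bU; rewrite (_ : mu \o _ = nu \o (fun k => F k `&` B)).
    by apply: norm_cvg_unique; exact: hnu.
  by apply/funext => k /=; rewrite nF.
- by rewrite -measurable_positivityE.
Qed.

End uniqueness.

(** * The potential operator and its representing measure *)

Lemma CL_bounded_integrable (R : realType) (n : nat) (f : CL R n) :
  bounded_integrable f.
Proof.
have /CL_predP[cf bf intf] := CL_funP f; split => //.
exact: continuous_measurable_rV.
Qed.

Lemma CL_le_sup (R : realType) (n : nat) (f : CL R n) y :
  `|f y| <= sup (range (fun y => `|f y|)).
Proof.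
have /CL_predP[_ /bounded_fun_rVP[M fM] _] := CL_funP f.
by apply: ub_le_sup; [exists M => _ [z _ <-]|exists y].
Qed.

Theorem theorem9 (R : realType) (n : nat) (hn : (3 <= n)%N) (x : 'rV[R]_n)
    (d : measure_display) (Omega : measurableType d) (P : probability Omega R)
    (X : R -> Omega -> 'rV[R]_n) (Q : R -> R.-pker 'rV[R]_n ~> 'rV[R]_n)
    (p : R -> 'rV[R]_n -> 'rV[R]_n -> R) (C0 c0 C1 c1 : R)
    (hX : homogeneous_markov P X Q x) (hp : transition_density Q p)
    (hC0 : 0 < C0) (hc0 : 0 < c0) (hC1 : 0 < C1) (hc1 : 0 < c1)
    (hbounds : gaussian_bounds p C0 c0 C1 c1) :
  [/\ forall f : CL R n, cvg (time_integral P X f T @[T --> +oo]),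
      linear (potential P X : CL R n -> L1 P),
      continuous (potential P X : CL R n -> L1 P)
    & exists mu : set 'rV[R]_n -> L1 P,
      [/\ vector_radon_measure mu,
          forall f : CL R n, is_vintegral_space mu f (potential P X f)
        & forall nu : set 'rV[R]_n -> L1 P, vector_radon_measure nu ->
            (forall f : CL R n, is_vintegral_space nu f (potential P X f)) ->
            forall A, bounded_borel A -> nu A = mu A]].
Proof.
pose K := @occupation_constant R n C1.
have K0 : 0 <= K by exact: occupation_constant_ge0.
have time_cvg (f : CL R n) : time_integral P X f T @[T --> +oo] --> occupation P X f.
  exact: (cvg_time_integral hX hp hC0 hC1 hc1 hbounds hn (CL_bounded_integrable f)).
have potentialE (f : CL R n) : potential P X f = occupation P X f.
  exact: norm_cvg_lim (time_cvg f).
have potential_linear : linear (potential P X : CL R n -> L1 P).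
  move=> a f g; rewrite !potentialE.
  by apply: (occupation_linear hX hp hC0 hC1 hc1 hbounds hn); exact: CL_bounded_integrable.
have potential_le (f : CL R n) : `|potential P X f| <= (1 + K) * `|f|.
  rewrite potentialE; apply: le_trans
    (le_occupation_norm hX hp hC0 hC1 hc1 hbounds hn
      (@CL_le_sup _ _ f) (CL_bounded_integrable f)) _.
  rewrite -/K CL_normE mulrDl mul1r mulrDr.
  have s0 : 0 <= sup (range (fun y => `|f y|)) by apply: le_trans (CL_le_sup f 0).
  have i0 : 0 <= \int[lebesgue_rV n]_y `|f y| by exact: Rintegral_ge0.
  by rewrite -addrA lerD2l addrA lerDr addr_ge0// mulr_ge0.
split => //.
- by move=> f; apply/cvg_ex; exists (occupation P X f).
- move=> f W /nbhs_ballP[e /= e0 eW]; apply/nbhs_ballP.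
  exists (e / (1 + K)); first by rewrite /= divr_gt0// ltr_wpDr.
  move=> g; rewrite -ball_normE/= => fg; apply: eW; rewrite -ball_normE/=.
  have -> : potential P X f - potential P X g = potential P X (f - g).
    by rewrite addrC -scaleN1r -potential_linear scaleN1r addrC.
  apply: le_lt_trans (potential_le _) _.
  by rewrite mulrC -ltr_pdivlMr ?ltr_wpDr.
- exists (occupation_measure P X).
  have hmu := vector_radon_occupation hX hp hC0 hC1 hc1 hbounds hn.
  have hint (f : CL R n) :
      is_vintegral_space (occupation_measure P X) f (potential P X f).
    rewrite potentialE.
    exact: (is_vintegral_space_occupation hX hp hC0 hC1 hc1 hbounds hn (CL_bounded_integrable f)).
  split => // nu hnu nuint A; apply: (eq_vmeasure hnu hmu) => f.
  by exists (potential P X f).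
Qed.
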